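(* Fix a spin system on $\mathbb{Z}^d$ as described in the context, a region $V\in\mathbb{F}$ and a boundary condition $\tau\in\Omega_{V^c}$. Let $A_{i,j}\subset V$, $i=1,\dots,n$, $j=1,\dots,m$, be subsets with $\bigcup_{i,j}A_{i,j}=\Lambda\subset V$, and define the row subsets $R_i=\bigcup_{j=1}^mA_{i,j}$ and the column subsets $C_j=\bigcup_{i=1}^nA_{i,j}$. Assume that $\{R_i,\ i=1,\dots,n\}$ is a partition of $\Lambda$ and that $\mu_\Lambda$ is a product measure along this partition: $\mu_\Lambda=\otimes_{i=1}^n\mu_{R_i}$. Let $s_i>0$, $i=1,\dots,n$, be constants such that for each $i=1,\dots,n$ and all $f\ge0$, $$\operatorname{Ent}_{R_i}f\le s_i\sum_{j=1}^m\mu_{R_i}\big[\operatorname{Ent}_{A_{i,j}}f\big].$$ Then, for all $f\ge0$, $$\operatorname{Ent}_\Lambda f\le s\sum_{j=1}^m\mu_\Lambda\big[\operatorname{Ent}_{C_j}f\big],\qquad s=\max_i s_i.$$ (The sets $A_{i,1},\dots,A_{i,m}$ within a row are allowed to overlap.)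
   Context: Lattice and spin system. $\mathbb{Z}^d$ carries the nearest-neighbor graph structure: $xy$ is an edge iff $\sum_{i=1}^d|x_i-y_i|=1$; $\mathcal E$ is the set of edges and $d(\cdot,\cdot)$ the graph distance. For $\Lambda\subset\mathbb{Z}^d$, $\Lambda^c=\mathbb{Z}^d\setminus\Lambda$ and $\partial\Lambda=\{y\in\Lambda^c:\ d(y,\Lambda)=1\}$. $\mathbb{F}$ is the set of finite subsets of $\mathbb{Z}^d$. The single-spin space is an arbitrary probability space $(S,\mathscr S,\nu)$ (when $S$ is finite one may also take $\nu$ to be the counting measure). For $\Lambda\subset\mathbb{Z}^d$, $\Omega_\Lambda=S^\Lambda$ with the product $\sigma$-algebra, and $\nu_\Lambda=\otimes_{x\in\Lambda}\nu$. The pair potential $U:S\times S\to\mathbb{R}$ is bounded, measurable and symmetric; the single-site potential $W:S\to\mathbb{R}$ is bounded and measurable. For $\Lambda\in\mathbb{F}$, $\tau\in\Omega_{\Lambda^c}$, $$H_\Lambda^\tau(\sigma_\Lambda)=-\sum_{xy\in\mathcal E:\,x,y\in\Lambda}U(\sigma_x,\sigma_y)-\sum_{xy\in\mathcal E:\,x\in\Lambda,\,y\in\partial\Lambda}U(\sigma_x,\tau_y)-\sum_{x\in\Lambda}W(\sigma_x),$$ and the Gibbs measure is $\mu_\Lambda^\tau(d\sigma_\Lambda)=\frac1{Z_\Lambda^\tau}e^{-H_\Lambda^\tau(\sigma_\Lambda)}\nu_\Lambda(d\sigma_\Lambda)$, with $Z^\tau_\Lambda$ the normalizing constant. If $S$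 is finite, $U$ is also allowed to take the value $-\infty$ (hard constraints), provided the system is permissive (for every $\Lambda\in\mathbb{F}$ and $\tau\in\Omega_{\Lambda^c}$ some $\sigma_\Lambda$ has $\mu_\Lambda^\tau(\sigma_\Lambda)>0$) and irreducible (for every $\Lambda\in\mathbb{F}$, $\tau\in\Omega_{\Lambda^c}$, the single-site heat bath Markov chain, which resamples one spin at a time from its conditional distribution, is irreducible on $\{\sigma_\Lambda:\mu_\Lambda^\tau(\sigma_\Lambda)>0\}$). Notation. $V$ and $\tau\in\Omega_{V^c}$ are fixed; $\mu f=\mu_V^\tau f$ is the expectation and $\operatorname{Ent}f=\operatorname{Ent}_V^\tau f=\mu[f\log(f/\mu f)]$. For $\Lambda\subset V$, $\mu_\Lambda f$ and $\operatorname{Ent}_\Lambda f=\mu_\Lambda[f\log(f/\mu_\Lambda f)]$ denote expectation and entropy of $f$ with respect to $\mu_\Lambda^\eta$, where the (implicit) boundary condition $\eta\in\Omega_{\Lambda^c}$ agrees with $\tau$ on $V^c$ and is given by the current configuration on $V\setminus\Lambda$; they are functions of the spins in $V\setminus\Lambda$, and identities and inequalities between such functions are understood to hold for ($\mu$-almost) every choice of the implicit boundary condition. ''$f\ge0$'' means: $f:\Omega_V\to[0,\infty)$ measurable with $f\log^+f\in L^1(\mu)$. Convention: $\mu_\emptyset f=f$, $\operatorname{Ent}_\emptyset f=0$. The product assumption $\mu_\Lambda=\otimes_i\mu_{R_i}$ means that, for given spins outside $\Lambda$, the configurations in the $R_i$ are independent under $\mu_\Lambda$, so that each $\mu_{R_i}$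 does not depend on the spins in $\Lambda\setminus R_i$. *)

(* Defs.v *)
From HB Require Import structures.
From mathcomp Require Import all_boot all_order all_algebra finmap.
From mathcomp Require Import all_classical all_reals all_analysis.
From mathcomp Require Import measurable_realfun.
From Stdlib Require Import Relation_Operators.

Import Order.TTheory GRing.Theory Num.Theory.

Local Open Scope classical_set_scope.
Local Open Scope ring_scope.
Local Open Scope ereal_scope.

Definition config (I T : Type) : Type := I -> T.

HB.instance Definition _ (I : Type) (T : pointedType) :=
  Pointed.copy (config I T) (I -> T).

Definition config_display : measure_display -> measure_display.
Proof. exact. Qed.

Section product_sigma_algebra.
Context {disp : measure_display} {T : measurableType disp} (I : Type).

Definition cylinders : set (set (config I T)) :=
  \bigcup_(i in [set: I])
    preimage_set_system setT (fun w : config I T => w i) measurable.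

Let config_set0 : <<s cylinders >> set0.
Proof. exact: sigma_algebra0. Qed.

Let config_setC B : <<s cylinders >> B -> <<s cylinders >> (~` B).
Proof. exact: sigma_algebraC. Qed.

Let config_bigcup (F : (set (config I T))^nat) :
  (forall i, <<s cylinders >> (F i)) -> <<s cylinders >> (\bigcup_i (F i)).
Proof. exact: sigma_algebra_bigcup. Qed.

HB.instance Definition _ := @isMeasurable.Build (config_display disp)
  (config I T) <<s cylinders >> config_set0 config_setC config_bigcup.

End product_sigma_algebra.

(** The library only has binary products of measures: the product measure on
    [config I S], [I] finite, is the image of the iterated binary product on
    [#|I|]-tuples under the enumeration of [I]. *)

Section product_measure.
Context {R : realType} {disp : measure_display} {S : measurableType disp}.
Variable nu : {finite_measure set S -> \bar R}.

Fixpoint tuple_measure (n : nat) : set (n.-tuple S) -> \bar R :=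
  if n is k.+1 then
    pushforward (nu \x tuple_measure k)
      (fun p : S * k.-tuple S => [the k.+1.-tuple S of p.1 :: p.2])
  else dirac [the 0.-tuple S of [::]].

Definition config_measure (I : finType) : set (config I S) -> \bar R :=
  pushforward (tuple_measure #|I|)
    (fun t => (fun i => tnth t (enum_rank i)) : config I S).

End product_measure.

Notation site d := 'rV[int]_d.

Definition nn {d : nat} (x y : site d) : bool :=
  (\sum_(i < d) `|x ord0 i - y ord0 i| == 1)%R.

(** [y] lies outside [L], at graph distance 1 from [L]. *)
Definition boundary {d : nat} (L : {fset site d}) : set (site d) :=
  [set y | y \notin L /\ exists2 x, x \in L & nn x y].

(** Boundary conditions are total configurations [w : site d -> S] of which
    only the values outside the relevant region are used: [splice xi w] equals
    [xi] on [L] and [w] outside [L]. *)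

Definition splice {d : nat} {S : Type} {L : {fset site d}}
    (xi : config L S) (w : site d -> S) : site d -> S :=
  fun x => if insub x is Some u then xi u else w x.

Definition restr {d : nat} {S : Type} (L : {fset site d})
    (w : site d -> S) : config L S := fun u => w (val u).

Record interaction (R : realType) {disp : measure_display}
    (S : measurableType disp) := Interaction {
  base : {finite_measure set S -> \bar R} ;
  pairU : S -> S -> \bar R ;
  siteW : S -> R }.

Arguments base {R disp S}.
Arguments pairU {R disp S}.
Arguments siteW {R disp S}.

Section spin_system.
Context {d : nat} {R : realType} {disp : measure_display}.
Context {S : measurableType disp}.

Variable X : interaction R S.
Notation U := (pairU X).
Notation W := (siteW X).
Implicit Types (L : {fset site d}) (w : site d -> S).

(** H_L^tau(xi) is [hamiltonian L (splice xi tau)]. The comparison of [pickle]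
    codes selects one orientation of each unordered edge inside [L]. *)
Definition hamiltonian L w : \bar R :=
  - (\sum_(x <- L)
       \sum_(y <- L | nn x y && (choice.pickle x < choice.pickle y)%N)
         U (w x) (w y))
  - (\sum_(x <- L) \sum_(y \in [set y | boundary L y /\ nn x y])
       U (w x) (w y))
  - (\sum_(x <- L) W (w x))%:E.

Definition boltzmann L w (xi : config L S) : \bar R :=
  expeR (- hamiltonian L (splice xi w)).

Definition partition_fun L w : \bar R :=
  \int[config_measure (base X) L]_xi boltzmann L w xi.

Definition gibbs L w (B : set (config L S)) : \bar R :=
  ((fine (partition_fun L w))^-1)%:E *
  \int[config_measure (base X) L]_(xi in B) boltzmann L w xi.

(** Transition probabilities of the heat bath chain on [config L S]: the spin
    at a uniformly chosen site [x] is resampled given all other spins. *)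
Definition heat_bath L w (sigma sigma' : config L S) : \bar R :=
  ((#|` L|%:R)^-1)%:E * \sum_(x : L)
    gibbs [fset val x]%fset (splice sigma w)
      [set xi | restr L (splice xi (splice sigma w)) = sigma'].

Definition permissive : Prop := forall L w,
  exists sigma : config L S, 0 < gibbs L w [set sigma].

Definition irreducible : Prop := forall L w (sigma sigma' : config L S),
  0 < gibbs L w [set sigma] -> 0 < gibbs L w [set sigma'] ->
  clos_refl_trans _ (fun a b => 0 < heat_bath L w a b) sigma sigma'.

Definition finite_spins : Prop :=
  finite_set [set: S] /\ forall B : set S, measurable B.

Record is_spin_system : Prop := {
  base_prob : base X setT = 1 \/
    finite_spins /\ forall B : set S, base X B = counting B ;
  pairU_sym : forall a b, U a b = U b a ;
  pairU_measurable : measurable_fun setT (fun p : S * S => U p.1 p.2) ;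
  pairU_values :
    (exists M : R, forall a b, `|U a b| <= M%:E) \/
    [/\ finite_spins, forall a b, U a b < +oo, permissive & irreducible] ;
  siteW_measurable : measurable_fun setT W ;
  siteW_bounded : exists M : R, forall a, (`|W a| <= M)%R }.

(** For [L] included in [V], the implicit boundary condition of [mu_L] is
    [splice sigma tau] outside [L]: functions of the spins in [V \ L] are
    represented as functions of [sigma : config V S] that ignore the spins in
    [L]. *)

Variables (V : {fset site d}) (tau : site d -> S).

Definition expect L (f : config V S -> \bar R) (sigma : config V S) : \bar R :=
  \int[gibbs L (splice sigma tau)]_xi
    f (restr V (splice xi (splice sigma tau))).

Definition Ent L (f : config V S -> R) : config V S -> \bar R :=
  expect L (fun sigma =>
    (f sigma * ln (f sigma / fine (expect L (EFin \o f) sigma)))%:E).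

(** The class of functions meant by "f >= 0". *)
Definition nonneg_LlogL (f : config V S -> R) : Prop :=
  [/\ measurable_fun setT f, forall sigma, (0 <= f sigma)%R &
      (gibbs V tau).-integrable setT
        (fun sigma => (f sigma * Num.max 0 (ln (f sigma)))%:E)].

(** [mu_L] is the product of the [mu_(P i)]: equality with the product
    measure is equality on all boxes. *)
Definition product_along L {n : nat} (P : 'I_n -> {fset site d}) : Prop :=
  {ae gibbs V tau, forall sigma : config V S,
    forall B : forall i, set (config (P i) S),
    (forall i, measurable (B i)) ->
    gibbs L (splice sigma tau)
      [set xi | forall i, B i (restr (P i) (splice xi (splice sigma tau)))] =
    \prod_(i < n) gibbs (P i) (splice sigma tau) (B i)}.

End spin_system.

Arguments is_spin_system d {R disp S} X.

Definition rows {d n m : nat} (A : 'I_n -> 'I_m -> {fset site d}) (i : 'I_n) :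
  {fset site d} := (\bigcup_(j <- enum 'I_m) A i j)%fset.

Definition columns {d n m : nat} (A : 'I_n -> 'I_m -> {fset site d})
  (j : 'I_m) : {fset site d} := (\bigcup_(i <- enum 'I_n) A i j)%fset.

(* Main.v *)
Require Import Defs.
From HB Require Import structures.
From mathcomp Require Import all_boot all_order all_algebra finmap.
From mathcomp Require Import all_classical all_reals all_analysis.
From mathcomp Require Import measurable_realfun lra ring.

(** Rows are added one at a time. Let K be a row, let R be the union of the rows
    already treated, and write T_B for the conditional expectation mu_B, P_j and
    Q_j for the parts of the j-th column in K and in R. The chain rule gives
      Ent_(K u R) f = T_(K u R) Ent_K f + Ent_(K u R) (T_K f),
    and the row inequality bounds the first term by the Ent_(P_j) f. For the
    second one, the main tool is: if K, C are included in M and T_K T_C = T_M,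
    then Ent_M (T_K g) <= T_M Ent_C g (Young's inequality applied to
    [ln (T_K g / T_M g)]). Here T_K T_C = T_(K u Q)
      whenever Q = C \ K lies in the
    other rows, by the product assumption. The tool is used for C = R and
    g = T_K f, and, after the induction hypothesis and
    T_(K u Q_j) Ent_(Q_j) <= Ent_(K u Q_j), for C = P_j u Q_j and g = T_(P_j)
      f. The
    chain rule Ent_(P_j u Q_j) f = T Ent_(P_j) f + Ent_(P_j u Q_j) (T_(P_j) f)
    collects the two contributions.

    Entropies are handled as integrals of the nonnegative Bregman divergence
    [ent_gap], so that all of these identities hold in [0, +oo]. *)

Set Implicit Arguments.
Unset Strict Implicit.

Import Order.TTheory GRing.Theory Num.Theory.

Local Open Scope classical_set_scope.
Local Open Scope ring_scope.
Local Open Scope ereal_scope.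

(** * Relative entropy on a probability space *)

(** The constant does not deteriorate because the chain rule is an identity. The new row contributes
    at most [s_i <= s] times the entropies of the P_j, the rows already treated contribute at most
    [s] times those of the Q_j, and one chain rule per column adds the two up exactly. This is why
    the tool is applied to T_(P_j) f and not to f: it has to produce only the part of the column
    entropy that Ent_(P_j) f leaves over. As T_K T_(P_j) = T_K, this replacement does not change T_K
    f, and overlaps among the P_j do no harm. Two obstacles shape the rest. The product assumption
    speaks of mu_L alone, while the commutation is needed in the smaller set K u Q; it is
    transferred by freezing the spins outside K u Q. And all hypotheses hold only for almost every
    boundary condition, so null sets of mu have to be passed on to the conditional measures, and the
    null set of the product property must serve all test functions at once. Moreover the induction
    hypothesis is used at T_K f, so the admissible class must be stable under conditional
    expectation. *)

Section entropy_integrand.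
Context {R : realType}.
Implicit Types a b c t : R.

(** The Bregman divergence of [x ln x]. The value [0] at [b = 0] matches the
    junk value [ln (a / 0) = 0], so [integral_xlnx] has no side condition. *)
Definition ent_gap a b : R :=
  (if 0 < b then Num.max 0 (a * (ln a - ln b) - a + b) else 0)%R.

Lemma ent_gap_ge0 a b : (0 <= ent_gap a b)%R.
Proof. by rewrite /ent_gap; case: ifP => // _; rewrite le_max lexx. Qed.

Lemma ent_gap0r a : ent_gap a 0 = 0%R.
Proof. by rewrite /ent_gap ltxx. Qed.

(** Convex duality between [a * (ln a - ln b) - a + b] and [b * (expR t - 1)]. It is
    [1 + u <= expR u] at [u = t - (ln a - ln b)], multiplied by [a], since then
    [a * expR u = b * expR t]. *)
Lemma young_raw a b t : (0 <= a -> 0 < b ->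
  a * t <= a * (ln a - ln b) - a + b + b * (expR t - 1))%R.
Proof.
move=> a0 b0; have et : (0 < expR t)%R by exact: expR_gt0.
have := a0; rewrite le_eqVlt => /predU1P[<-|a_gt0].
  have : (0 <= b * expR t)%R by rewrite mulr_ge0 ?ltW.
  by rewrite !mul0r; lra.
have := expR_ge1Dx (t - (ln a - ln b)).
rewrite expRD opprB expRD expRN !lnK ?posrE// => h.
have : (a * (1 + (t + (ln b - ln a))) <= a * (expR t * (b * a^-1)))%R.
  by rewrite ler_pM2l.
have -> : (a * (expR t * (b * a^-1)) = b * expR t)%R.
  by field; rewrite gt_eqF.
lra.
Qed.

(** The truncation in [ent_gap] gives nonnegativity for all real arguments. On this range it is
    inactive, by Young's inequality at [t = 0]. *)
Lemma ent_gapE a b : (0 <= a -> 0 < b ->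
  ent_gap a b = a * (ln a - ln b) - a + b)%R.
Proof.
move=> a0 b0; rewrite /ent_gap b0; apply/max_idPr.
by have := young_raw 0 a0 b0; rewrite expR0 subrr !mulr0 addr0.
Qed.

Lemma ent_gap0l b : (0 <= b -> ent_gap 0 b = b)%R.
Proof.
rewrite le_eqVlt => /predU1P[<-|b0]; first exact: ent_gap0r.
by rewrite ent_gapE// mul0r subrr add0r.
Qed.

Lemma ent_gapxx a : (0 <= a -> ent_gap a a = 0)%R.
Proof.
rewrite le_eqVlt => /predU1P[<-|a0]; first exact: ent_gap0r.
by rewrite ent_gapE ?ltW// subrr mulr0 add0r addNr.
Qed.

Lemma young a b t : (0 <= a -> 0 < b ->
  a * t <= ent_gap a b + b * (expR t - 1))%R.
Proof. by move=> a0 b0; rewrite ent_gapE//; exact: young_raw. Qed.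

(** The cross term is affine in [a] and vanishes at [a = b], so it integrates to zero as soon as [a]
    is a function of mean [b]. *)
Lemma ent_gap_three_point a b c : (0 <= a -> 0 < b -> 0 < c ->
  ent_gap a c = ent_gap a b + (a - b) * (ln b - ln c) + ent_gap b c)%R.
Proof. by move=> a0 b0 c0; rewrite (ent_gapE a0 c0) (ent_gapE a0 b0)
  (ent_gapE (ltW b0) c0); ring. Qed.

Lemma measurable_ent_gap d (T : measurableType d) (f g : T -> R) :
  measurable_fun setT f -> measurable_fun setT g ->
  measurable_fun setT (fun x => ent_gap (f x) (g x)).
Proof.
move=> mf mg; apply: measurable_fun_ifT => //.
- by apply: measurable_fun_ltr => //; exact: measurable_cst.
- apply: measurable_maxr; first exact: measurable_cst.
  apply: measurable_funD => //; apply: measurable_funB => //.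
  apply: measurable_funM => //.
  by apply: measurable_funB; apply: measurableT_comp => //;
    exact: measurable_ln.
Qed.

End entropy_integrand.

(** * Entropy identities and the commuting inequality for one probability measure *)

Section probability_lemmas.
Context d (T : measurableType d) (R : realType) (P : probability T R).
Implicit Types f g a b k : T -> R.

Lemma eint_cst (r : R) : \int[P]_x r%:E = r%:E.
Proof. by rewrite -[RHS]mule1 -(probability_setT P) -integral_cst. Qed.

Lemma ge0_eintD f g : measurable_fun setT f -> measurable_fun setT g ->
  (forall x, 0 <= f x)%R -> (forall x, 0 <= g x)%R ->
  \int[P]_x (f x + g x)%:E = \int[P]_x (f x)%:E + \int[P]_x (g x)%:E.
Proof.
move=> mf mg f0 g0; under eq_integral do rewrite EFinD.
by rewrite ge0_integralD//; try (by move=> x _; rewrite lee_fin);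
  exact/measurable_EFinP.
Qed.

Lemma ge0_eintZr f (r : R) : measurable_fun setT f ->
  (forall x, 0 <= f x)%R -> (0 <= r)%R ->
  \int[P]_x (f x * r)%:E = \int[P]_x (f x)%:E * r%:E.
Proof.
move=> mf f0 r0; under eq_integral do rewrite EFinM.
by rewrite ge0_integralZr//; try (by move=> x _; rewrite lee_fin);
  exact/measurable_EFinP.
Qed.

Lemma ge0_eint_eq0 f : measurable_fun setT f -> (forall x, 0 <= f x)%R ->
  \int[P]_x (f x)%:E = 0 -> {ae P, forall x, f x = 0%R}.
Proof.
move=> mf f0 If.
have /ae_eq_integral_abs : measurable_fun setT (EFin \o f)
  by exact/measurable_EFinP.
move=> /(_ P measurableT)[+ _].
under eq_integral do rewrite /= ger0_norm//.
by move=> /(_ If); apply: filterS => x /(_ I)[].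
Qed.

(** The integrated three-point identity: measuring against [c] instead of the mean [b] costs exactly
    [ent_gap b c]. Applied to conditional measures it yields the chain rule, and with [c = 1]
    Jensen's inequality. *)
Lemma ent_gap_compensation f (b c : R) : measurable_fun setT f ->
  (forall x, 0 <= f x)%R -> (0 < c)%R -> \int[P]_x (f x)%:E = b%:E ->
  \int[P]_x (ent_gap (f x) c)%:E =
  \int[P]_x (ent_gap (f x) b)%:E + (ent_gap b c)%:E.
Proof.
move=> mf f0 c0 If.
have : (0 <= b)%R by rewrite -lee_fin -If integral_ge0// => x _;
  rewrite lee_fin.
rewrite le_eqVlt => /predU1P[b0|b0].
  (* Mean zero forces [f = 0] almost everywhere, so the left side is the integral of [ent_gap 0 c],
     and the first term on the right vanishes by the convention for a zero reference. *)
  rewrite -b0 in If *.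
  have fae := ge0_eint_eq0 mf f0 If.
  under [X in _ = X + _]eq_integral do rewrite ent_gap0r.
  rewrite eint_cst add0e -(eint_cst (ent_gap 0 c)).
  apply: ge0_ae_eq_integral => //.
  - by apply/measurable_EFinP/measurable_ent_gap => //; exact: measurable_cst.
  - by move=> x _; rewrite lee_fin ent_gap_ge0.
  - by move=> x _; rewrite lee_fin ent_gap_ge0.
  - by apply: filterS fae => x -> _.
set t := (ln b - ln c)%R.
pose tp : R := (Num.max 0 t)%R; pose tn : R := (Num.max 0 (- t))%R.
have tp0 : (0 <= tp)%R by rewrite le_max lexx.
have tn0 : (0 <= tn)%R by rewrite le_max lexx.
have tE : (t = tp - tn)%R by rewrite /tp /tn !maxEle; case: ifP; case: ifP; lra.
have mgap r : measurable_fun setT (fun x => ent_gap (f x) r).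
  by apply: measurable_ent_gap => //; exact: measurable_cst.
have mfr r : measurable_fun setT (fun x => f x * r)%R.
  by apply: measurable_funM => //; exact: measurable_cst.
(* the three-point identity, with all negative terms moved across, so that
   no integrability of the entropy is needed *)
have : \int[P]_x (ent_gap (f x) c + (f x * tn + b * tp))%:E =
       \int[P]_x (ent_gap (f x) b + (f x * tp + (b * tn + ent_gap b c)))%:E.
  apply: eq_integral => x _; congr EFin.
  by rewrite (ent_gap_three_point (f0 x) b0 c0) -/t tE; ring.
have mc (r : R) : measurable_fun setT (fun _ : T => r) by exact: measurable_cst.
have g0 (u v : R) : (0 <= ent_gap u v)%R by exact: ent_gap_ge0.
have nn (r r' : R) : (0 <= r -> 0 <= r' -> 0 <= r * r')%R by exact: mulr_ge0.
have bb := ltW b0.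
rewrite (ge0_eintD (mgap _))//; last 2 first.
  - by apply: measurable_funD => //.
  - by move=> x; rewrite addr_ge0 ?nn.
rewrite (ge0_eintD (mfr tn) (mc _))//; last 2 first.
  - by move=> x; rewrite nn.
  - by move=> x; rewrite nn.
rewrite (ge0_eintD (mgap _))//; last 2 first.
  - by apply: measurable_funD => //.
  - by move=> x; rewrite !addr_ge0 ?nn ?ent_gap_ge0.
rewrite (ge0_eintD (mfr tp) (mc _))//; last 2 first.
  - by move=> x; rewrite nn.
  - by move=> x; rewrite !addr_ge0 ?nn ?ent_gap_ge0.
rewrite !ge0_eintZr// If !eint_cst -!EFinM -!EFinD => h.
have : \int[P]_x (ent_gap (f x) c)%:E + (b * tn + b * tp)%:E =
  (\int[P]_x (ent_gap (f x) b)%:E + (ent_gap b c)%:E) + (b * tn + b * tp)%:E.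
  by rewrite h -addeA -EFinD; congr (_ + _); congr EFin; ring.
move=> e; apply/le_anti/andP.
by split; rewrite -(@leeD2rE _ (b * tn + b * tp)%:E)// e.
Qed.

(** Think of [k], [b], [c] as conditional expectations of [a] given
    sigma-algebras K, C, M; the hypotheses say that projecting [a] on K gives
      [k]
    and that projecting [b] on K gives [c], that is, K and C commute over M. *)
Lemma ent_gap_le_of_commuting a b k (c : R) :
  measurable_fun setT a -> measurable_fun setT b -> measurable_fun setT k ->
  (forall x, 0 <= a x)%R -> (forall x, 0 <= b x)%R -> (forall x, 0 <= k x)%R ->
  (0 < c)%R -> \int[P]_x (k x)%:E = c%:E ->
  {ae P, forall x, b x = 0%R -> a x = 0%R} ->
  (forall g : R -> R, measurable_fun setT g -> (forall y, 0 <= g y)%R ->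
    \int[P]_x (a x * g (k x))%:E = \int[P]_x (k x * g (k x))%:E) ->
  (forall g : R -> R, measurable_fun setT g -> (forall y, 0 <= g y)%R ->
    \int[P]_x (b x * g (k x))%:E = c%:E * \int[P]_x (g (k x))%:E) ->
  \int[P]_x (ent_gap (k x) c)%:E <= \int[P]_x (ent_gap (a x) (b x))%:E.
Proof.
move=> ma mb mk a0 b0 k0 c0 Ik ab Ha Hb.
(* The test function is the indicator of [0]. The set where [k] vanishes needs care because
   [ln 0 = 0] makes [t] below differ from the true value minus infinity. *)
have aek : {ae P, forall x, k x = 0%R -> a x = 0%R}.
  have m1 : measurable_fun setT (\1_[set 0%R] :
    R -> R) by exact: measurable_indic.
  have i0 (y : R) : (0 <= \1_[set (0 : R)%R] y :> R)%R by rewrite indicE ler0n.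
  have := Ha _ m1 i0.
  under [X in _ = X -> _]eq_integral => x _.
    have -> : (k x * \1_[set 0%R] (k x) = 0 :> R)%R.
      by rewrite indicE; case: (boolP (_ \in _)); rewrite ?mulr0// inE => ->;
        rewrite mul0r.
    over.
  rewrite integral0 => /ge0_eint_eq0 h.
  have {h} := h (measurable_funM ma (measurableT_comp m1 mk)) (fun x =>
    mulr_ge0 (a0 x) (i0 _)).
  apply: filterS => x + kx0; rewrite kx0 indicE mem_set// mulr1//.
pose t (y : R) : R := (ln y - ln c)%R.
have mt : measurable_fun setT t.
  by apply: measurable_funB; [exact: measurable_ln|exact: measurable_cst].
(* The hypotheses [Ha] and [Hb] admit only nonnegative test functions, so the logarithm is split
   into its two parts. *)
pose tp (y : R) : R := (Num.max 0 (t y))%R;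
  pose tn (y : R) : R := (Num.max 0 (- t y))%R.
have mtp : measurable_fun setT tp by apply: measurable_maxr => //;
  exact: measurable_cst.
have mtn : measurable_fun setT tn.
  by apply: measurable_maxr; [exact: measurable_cst|exact: measurableT_comp].
have tp0 y : (0 <= tp y)%R by rewrite le_max lexx.
have tn0 y : (0 <= tn y)%R by rewrite le_max lexx.
have tE y : (t y = tp y - tn y)%R by rewrite /tp /tn !maxEle; case: ifP;
  case: ifP; lra.
have mtpk : measurable_fun setT (tp \o k) by exact: measurableT_comp.
have mtnk : measurable_fun setT (tn \o k) by exact: measurableT_comp.
have mgap : measurable_fun setT (fun x => ent_gap (k x) c).
  by apply: measurable_ent_gap => //; exact: measurable_cst.
have mgap' := measurable_ent_gap ma mb.
have mc (r : R) : measurable_fun setT (fun _ : T => r) by exact: measurable_cst.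
have g0 (u v : R) : (0 <= ent_gap u v)%R by exact: ent_gap_ge0.
have c0' := ltW c0.
(* Nonnegativity of [ent_gap (k x) c] reads [- k t <= c - k]. The resulting finite integral of the
   negative part is what may be cancelled at the end. *)
have ktn x : (k x * tn (k x) <= c)%R.
  have := k0 x; rewrite le_eqVlt => /predU1P[<-|kx0]; first by rewrite mul0r.
  have := ent_gap_ge0 (k x) c; rewrite ent_gapE// -/(t _) => h.
  rewrite /tn maxEle; case: ifP => _; last by rewrite mulr0.
  by rewrite mulrN; lra.
have Bfin : \int[P]_x (k x * tn (k x))%:E \is a fin_num.
  rewrite ge0_fin_numE; last by apply: integral_ge0 => x _;
    rewrite lee_fin mulr_ge0.
  apply: (@le_lt_trans _ _ (\int[P]_x c%:E)); last by rewrite eint_cst ltry.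
  apply: ge0_le_integral => //.
  - by move=> x _; rewrite lee_fin mulr_ge0.
  - by apply/measurable_EFinP/measurable_funM.
  - by move=> x _; rewrite lee_fin.
have e1 : \int[P]_x (ent_gap (k x) c)%:E + (\int[P]_x (k x * tn (k x))%:E +
  c%:E) =
    \int[P]_x (k x * tp (k x))%:E + c%:E.
  rewrite -{1}Ik -(eint_cst c).
  have mktn := measurable_funM mk mtnk; have mktp := measurable_funM mk mtpk.
  rewrite -(ge0_eintD mktn)//; last by move=> x; rewrite /= mulr_ge0.
  rewrite -(ge0_eintD mgap)//; last 2 first.
  - exact: measurable_funD.
  - by move=> x; rewrite /= !addr_ge0 ?g0 ?mulr_ge0 ?invr_ge0 ?normr_ge0.
  rewrite -(ge0_eintD mktp)//; last by move=> x; rewrite /= mulr_ge0.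
  apply: eq_integral => x _; congr EFin.
  by rewrite /= (ent_gapE (k0 x) c0) -/(t _) tE; ring.
(* Young's inequality with [t = ln (k / c)] *)
have e2 : \int[P]_x (a x * tp (k x))%:E + \int[P]_x (b x)%:E <=
    \int[P]_x (ent_gap (a x) (b x))%:E + (\int[P]_x (a x * tn (k x))%:E +
    \int[P]_x (b x * (`|k x| / c))%:E).
  have matn := measurable_funM ma mtnk; have matp := measurable_funM ma mtpk.
  (* For [k x > 0] the factor is [expR (t (k x))]. The absolute value makes it a test function that
     is nonnegative on the whole line, as [Hb] demands. *)
  have mbk : measurable_fun setT (fun x => b x * (`|k x| / c))%R.
    apply: measurable_funM => //; apply: measurable_funM => //.
    exact: measurableT_comp.
  have bk0 x : (0 <= b x * (`|k x| / c))%R by rewrite mulr_ge0 ?divr_ge0.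
  rewrite -(ge0_eintD matp)//; last by move=> x; rewrite /= mulr_ge0.
  rewrite -(ge0_eintD matn)//; last by move=> x; rewrite /= mulr_ge0.
  rewrite -(ge0_eintD mgap')//; last 2 first.
  - exact: measurable_funD.
  - by move=> x; rewrite /= !addr_ge0 ?g0 ?mulr_ge0 ?invr_ge0 ?normr_ge0.
  apply: ae_ge0_le_integral => //.
  - by move=> x _; rewrite lee_fin /= !addr_ge0 ?g0 ?mulr_ge0 ?invr_ge0
      ?normr_ge0.
  - by apply/measurable_EFinP/measurable_funD.
  - by move=> x _; rewrite lee_fin /= !addr_ge0 ?g0 ?mulr_ge0 ?invr_ge0
      ?normr_ge0.
  - by apply/measurable_EFinP/measurable_funD => //; exact: measurable_funD.
  (* Where [b x = 0] both sides are zero; where [k x = 0] one has [a x = 0] and both sides equal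
     [b x]. Young's inequality is needed only elsewhere. *)
  apply: filterS2 ab aek => x abx akx _; rewrite lee_fin /=.
  have := b0 x; rewrite le_eqVlt => /predU1P[bx0|bx0].
    by rewrite (abx (esym bx0)) -bx0 ent_gap0r !mul0r !addr0.
  have := k0 x; rewrite le_eqVlt => /predU1P[kx0|kx0].
    by rewrite (akx (esym kx0)) -kx0 normr0 !mul0r mulr0 add0r !addr0 ent_gap0l.
  have := young (t (k x)) (a0 x) bx0.
  rewrite {2}/t expRD expRN !lnK ?posrE// tE gtr0_norm//; lra.
(* By [Hb], both [b] and [b * (|k| / c)] integrate to [c], so the remainder [b * (expR t - 1)] of
   Young's inequality contributes nothing. What is left is the integral of [k * t (k)], which [e1]
   identifies with the left side. *)
move: e2; rewrite (Ha _ mtp tp0) (Ha _ mtn tn0).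
have m1 : measurable_fun setT (fun _ : R => 1%R : R) by exact: measurable_cst.
have := Hb _ m1 (fun=> ler01); rewrite eint_cst mule1.
under eq_integral do rewrite mulr1.
move=> ->.
have mn : measurable_fun setT (fun y : R => `|y| / c)%R.
  by apply: measurable_funM => //; exact: measurableT_comp.
rewrite (Hb _ mn); last by move=> y; rewrite divr_ge0.
rewrite ge0_eintZr//; last 2 first.
- exact: measurableT_comp.
- by rewrite invr_ge0.
under [X in (c%:E * (X * _))]eq_integral do rewrite ger0_norm//.
rewrite Ik -!EFinM divff ?gt_eqF// mulr1 -e1.
by rewrite leeD2rE// fin_numD Bfin.
Qed.

(** The two integrands differ by [f - b], of mean zero. The negative part of [f ln (f / b)] is at
    most [b], so the left integral is well defined even when the entropy is infinite. *)
Lemma integral_xlnx f (b := fine (\int[P]_x (f x)%:E)) :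
  measurable_fun setT f -> (forall x, 0 <= f x)%R ->
  \int[P]_x (f x * ln (f x / b))%:E = \int[P]_x (ent_gap (f x) b)%:E.
Proof.
move=> mf f0.
have If0 : 0 <= \int[P]_x (f x)%:E by apply: integral_ge0 => x _;
  rewrite lee_fin.
have : (0 <= b)%R by exact: fine_ge0.
(* The case [b = 0] also covers an infinite mean, because [fine +oo = 0]; there both integrands are
   identically zero. *)
rewrite le_eqVlt => /predU1P[b0|b0].
  by apply: eq_integral => x _; rewrite -b0 ent_gap0r invr0 mulr0 ln0// mulr0.
have If : \int[P]_x (f x)%:E = b%:E.
  rewrite /b fineK// ge0_fin_numE// ltNge leye_eq; apply/negP => /eqP e.
  by move: b0; rewrite /b e ltxx.
pose g x : R := (f x * (ln (f x) - ln b))%R.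
have gE x : (f x * ln (f x / b) = g x)%R.
  have := f0 x; rewrite le_eqVlt => /predU1P[fx0|fx0];
    first by rewrite /g -fx0 !mul0r.
  by rewrite /g ln_div ?posrE.
have mg : measurable_fun setT g.
  apply: measurable_funM => //; apply: measurable_funB;
    last exact: measurable_cst.
  by apply: measurableT_comp => //; exact: measurable_ln.
have gap x : g x = (ent_gap (f x) b + f x - b)%R by rewrite ent_gapE// /g; ring.
pose gp x : R := Num.max (g x) 0%R; pose gn x : R := Num.max (- g x)%R 0%R.
have mgp : measurable_fun setT gp by apply: measurable_maxr => //;
  exact: measurable_cst.
have mgn : measurable_fun setT gn.
  by apply: measurable_maxr; [exact: measurableT_comp|exact: measurable_cst].
have gp0 x : (0 <= gp x)%R by rewrite le_max lexx orbT.
have gn0 x : (0 <= gn x)%R by rewrite le_max lexx orbT.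
have mgap : measurable_fun setT (fun x => ent_gap (f x) b).
  by apply: measurable_ent_gap => //; exact: measurable_cst.
have gap0 x := ent_gap_ge0 (f x) b.
have mb : measurable_fun setT (fun _ : T => b) by exact: measurable_cst.
have gnb x : (gn x <= b)%R.
  by rewrite /gn ge_max (ltW b0) andbT gap; have := f0 x; have := gap0 x; lra.
have gnfin : \int[P]_x (gn x)%:E \is a fin_num.
  rewrite ge0_fin_numE; last by apply: integral_ge0 => x _; rewrite lee_fin.
  apply: (@le_lt_trans _ _ (\int[P]_x b%:E)); last by rewrite eint_cst ltry.
  apply: ge0_le_integral => //.
  - by move=> x _; rewrite lee_fin.
  - exact/measurable_EFinP.
  - by move=> x _; rewrite lee_fin.
under eq_integral do rewrite gE.
rewrite integralE.
have -> : \int[P]_x ((fun x => (g x)%:E)^\+ x) = \int[P]_x (gp x)%:E.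
  by apply: eq_integral => x _; rewrite funeposE EFin_max.
have -> : \int[P]_x ((fun x => (g x)%:E)^\- x) = \int[P]_x (gn x)%:E.
  by apply: eq_integral => x _; rewrite funenegE EFin_max.
have : \int[P]_x (gp x + b)%:E = \int[P]_x ((ent_gap (f x) b + gn x) + f x)%:E.
  apply: eq_integral => x _; congr EFin.
  by have := gap x; rewrite /gp /gn !maxEle; case: ifP; case: ifP; lra.
rewrite ge0_eintD//; last by move=> x; exact: ltW.
rewrite ge0_eintD//; last 2 first.
- exact: measurable_funD.
- by move=> x; rewrite addr_ge0.
rewrite ge0_eintD// If eint_cst => h.
have {}h : \int[P]_x (gp x)%:E = \int[P]_x (ent_gap (f x)
  b)%:E + \int[P]_x (gn x)%:E.
  by apply/le_anti/andP; split; rewrite -(@leeD2rE _ b%:E)// h.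
by rewrite h addeK.
Qed.

End probability_lemmas.

(** * Finite product measures *)

Section config_measurability.
Context {disp : measure_display} {S : measurableType disp}.

Lemma measurable_coord (I : Type) (i : I) :
  measurable_fun setT (fun w : config I S => w i).
Proof.
move=> _ B mB; rewrite setTI; apply: sub_sigma_algebra; exists i => //.
by exists B => //; rewrite setTI.
Qed.

Lemma measurable_fun_configP (I : Type) d' (T : measurableType d')
    (f : T -> config I S) :
  (forall i, measurable_fun setT (fun x => f x i)) -> measurable_fun setT f.
Proof.
move=> mf; apply: (measurability (cylinders I)) => // _ [_ [i _ [B mB <-]] <-].
by rewrite !setTI -comp_preimage -[X in measurable X]setTI; exact: mf.
Qed.

Definition boxes (I : Type) : set (set (config I S)) :=
  [set Q | exists2 B : I -> set S, (forall i, measurable (B i)) &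
    Q = [set w | forall i, B i (w i)]].

Lemma setI_closed_boxes (I : Type) : setI_closed (@boxes I).
Proof.
move=> _ _ [B mB ->] [C mC ->]; exists (fun i => B i `&` C i).
  by move=> i; exact: measurableI.
apply/seteqP; split => [w [hB hC] i|w h]; first by split.
by split=> i; have [] := h i.
Qed.

Lemma measurable_box (I : finType) (B : I -> set S) :
  (forall i, measurable (B i)) ->
  measurable [set w : config I S | forall i, B i (w i)].
Proof.
move=> mB; rewrite [X in measurable X](_ : _ =
  \bigcap_(i in [set: I]) ((fun w : config I S => w i) @^-1` B i)).
  apply: fin_bigcap_measurable => [|i _]; first exact: finite_finset.
  by rewrite -[X in measurable X]setTI; exact: measurable_coord.
by apply/seteqP; split => [w h i _|w h i]; exact: h.
Qed.

Lemma measurable_boxesE (I : finType) :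
  measurable = <<s @boxes I >> :> set (set (config I S)).
Proof.
apply/seteqP; split; apply: smallest_sub.
- exact: smallest_sigma_algebra.
- move=> _ [i _ [B mB <-]]; apply: sub_sigma_algebra.
  exists (fun j => if `[< j = i >] then B else setT).
    by move=> j; case: asboolP => // _; exact: measurableT.
  rewrite setTI; apply/seteqP; split=> [w h j|w /(_ i)].
    by case: asboolP => // ->.
  by rewrite asboolT.
- exact: (sigma_algebra_measurable (config I S)).
- by move=> _ [B mB ->]; exact: measurable_box.
Qed.

(** Boxes form a pi-system that generates the sigma-algebra and contains the whole space. *)
Lemma config_measure_unique (R : realType) (I : finType)
    (m1 m2 : {measure set (config I S) -> \bar R}) :
  m1 setT < +oo ->
  (forall B : I -> set S, (forall i, measurable (B i)) ->
    m1 [set w | forall i, B i (w i)] = m2 [set w | forall i, B i (w i)]) ->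
  forall A, measurable A -> m1 A = m2 A.
Proof.
move=> fm h; apply: (measure_unique (@boxes I) (fun=> setT)) => //.
- exact: measurable_boxesE.
- exact: setI_closed_boxes.
- by move=> _; exists (fun=> setT) => //; apply/seteqP.
- by apply/seteqP; split=> // w _; exists 0%N.
- by move=> _ [B mB ->]; exact: h.
Qed.

End config_measurability.

Section finite_measure_of.
Context d (T : measurableType d) (R : realType).

Section bundle.
Variables (m : {measure set T -> \bar R}) (fm : m setT < +oo).

Let bundle : set T -> \bar R := m.
HB.instance Definition _ := Measure.on bundle.

Let bundle_fin : fin_num_fun bundle.
Proof.
move=> A mA; rewrite ge0_fin_numE//.
by apply: le_lt_trans fm; rewrite le_measure// inE.
Qed.
HB.instance Definition _ := Measure_isFinite.Build _ _ _ bundle bundle_fin.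

(** The existential form allows a raw set function to be exchanged for a bundled measure by
    rewriting. *)
Lemma finite_measureP :
  exists m' : {finite_measure set T -> \bar R}, m' = m :> (set T -> \bar R).
Proof. by exists bundle. Qed.

End bundle.

Lemma pushforward_measureP d' (T' : measurableType d') (phi : T -> T')
    (m : {measure set T -> \bar R}) : measurable_fun setT phi ->
  exists m' : {measure set T' -> \bar R}, m' = pushforward m phi :> (set T' ->
    \bar R).
Proof.
move=> mphi.
by exists (measure_function_pushforward__canonical__measure_function_Measure m
  mphi).
Qed.

End finite_measure_of.

Section product_measure_structure.
Context {R : realType} {disp : measure_display} {S : measurableType disp}.
Variable nu : {finite_measure set S -> \bar R}.

Lemma tuple_measureP n :
  exists2 m : {finite_measure set (n.-tuple S) -> \bar R},
    m = @tuple_measure _ _ _ nu n :> (set (n.-tuple S) -> \bar R) &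
    forall B : 'I_n -> set S, (forall i, measurable (B i)) ->
      m [set t | forall i, B i (tnth t i)] = \prod_(i < n) nu (B i).
Proof.
elim: n => [|n [m mE mB]].
  have [|m mE] := @finite_measureP _ _ _ (dirac [the 0.-tuple S of [::]] :
    {measure set _ -> \bar R}).
    by rewrite /= diracT ltry.
  exists m => // B mB; rewrite mE big_ord0 /= diracE mem_set//.
  by case.
pose phi (p : S * n.-tuple S) : n.+1.-tuple S := [the n.+1.-tuple S of p.1 ::
  p.2].
have mphi : measurable_fun setT phi.
  by apply: measurable_cons; [exact: measurable_fst|exact: measurable_snd].
have [m1 m1E] := pushforward_measureP (nu \x m)%E mphi.
have [|m' m'E] := @finite_measureP _ _ _ m1.
  have := @product_measure1E _ _ _ _ _ nu m setT setT measurableT measurableT.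
  rewrite setXTT => m1T; have -> : m1 setT = nu setT * m setT by rewrite m1E
    -m1T.
  by rewrite ltey_eq fin_numM// fin_num_measure.
exists m'.
  by rewrite m'E m1E /= -mE.
move=> B hB; rewrite m'E m1E /pushforward.
transitivity ((nu \x m) (B ord0 `*`
    [set t : n.-tuple S | forall i, B (lift ord0 i) (tnth t i)])).
  congr ((nu \x m) _).
  apply/seteqP; split=> [[x t] /= h|[x t] /= [h0 h] i].
    split; first by have := h ord0; rewrite (tnth_nth x).
    by move=> i; have := h (lift ord0 i); rewrite !(tnth_nth x).
  case: (unliftP ord0 i) => [j|] ->.
    by have := h j; rewrite !(tnth_nth x).
  by rewrite (tnth_nth x).
rewrite product_measure1E//.
  by rewrite big_ord_recl; congr (_ * _); exact: (mB (fun i =>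
    B (lift ord0 i))).
rewrite [X in measurable X](_ : _ =
  \bigcap_(i in [set: 'I_n]) ((fun t : n.-tuple S =>
    tnth t i) @^-1` B (lift ord0 i))).
  apply: fin_bigcap_measurable => [|i _]; first exact: finite_finset.
  by rewrite -[X in measurable X]setTI; exact: measurable_tnth.
by apply/seteqP; split => [w h i _|w h i]; exact: h.
Qed.

Lemma config_measureP (I : finType) :
  exists2 m : {finite_measure set (config I S) -> \bar R},
    m = @config_measure _ _ _ nu I :> (set (config I S) -> \bar R) &
    forall B : I -> set S, (forall i, measurable (B i)) ->
      m [set w | forall i, B i (w i)] = \prod_(i : I) nu (B i).
Proof.
have [m mE mB] := tuple_measureP #|I|.
pose phi (t : #|I|.-tuple S) : config I S := fun i => tnth t (enum_rank i).
have mphi : measurable_fun setT phi.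
  by apply: measurable_fun_configP => i; exact: measurable_tnth.
have [m1 m1E] := pushforward_measureP m mphi.
have [|m' m'E] := @finite_measureP _ _ _ m1.
  have -> : m1 setT = m setT by rewrite m1E.
  by rewrite ltey_eq fin_num_measure.
exists m'; first by rewrite m'E m1E /config_measure -mE.
move=> B hB; rewrite m'E m1E /pushforward.
transitivity (m [set t | forall i, B (enum_val i) (tnth t i)]).
  congr (m _); apply/seteqP; split=> t /= h i.
    by have := h (enum_val i); rewrite /phi enum_valK.
  by have := h (enum_rank i); rewrite enum_rankK.
rewrite (reindex _ (onW_bij _ (@enum_val_bij I))).
exact: (mB (fun i => B (enum_val i))).
Qed.

Section instance.
Variable I : finType.
Notation cm := (@config_measure R disp S nu I).

Let cm0 : cm set0 = 0.
Proof. by have [m <- _] := config_measureP I; rewrite measure0. Qed.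
Let cm_ge0 A : 0 <= cm A.
Proof. by have [m <- _] := config_measureP I. Qed.
Let cm_sigma_additive : semi_sigma_additive cm.
Proof.
by have [m <- _] := config_measureP I; exact: measure_semi_sigma_additive.
Qed.
HB.instance Definition _ := isMeasure.Build _ _ _ cm cm0 cm_ge0
  cm_sigma_additive.

Let cm_fin : fin_num_fun cm.
Proof.
by have [m <- _] := config_measureP I => A mA; exact: fin_num_measure.
Qed.
HB.instance Definition _ := Measure_isFinite.Build _ _ _ cm cm_fin.

Lemma config_measure_box (B : I -> set S) : (forall i, measurable (B i)) ->
  cm [set w | forall i, B i (w i)] = \prod_(i : I) nu (B i).
Proof. by have [m <- h] := config_measureP I; exact: h. Qed.

End instance.

End product_measure_structure.

(** * Splicing configurations *)

Section splice_theory.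
Context {d : nat} {S : Type}.
Implicit Types (L : {fset site d}) (w : site d -> S).

Definition agree_off L w w' := forall x, x \notin L -> w x = w' x.

Lemma splice_in L (xi : config L S) w x (Lx : x \in L) :
  splice xi w x = xi [` Lx]%fset.
Proof.
rewrite /splice; case: insubP => [u _ ux|]; last by rewrite Lx.
by congr xi; apply: val_inj; rewrite ux.
Qed.

Lemma splice_out L (xi : config L S) w : agree_off L (splice xi w) w.
Proof. by move=> x Lx; rewrite /splice; case: insubP => // u;
  rewrite (negbTE Lx). Qed.

Lemma splice_restr L w w' x :
  splice (restr L w) w' x = if x \in L then w x else w' x.
Proof. by case: ifPn => Lx; [rewrite splice_in|rewrite splice_out]. Qed.

Lemma restr_splice L (xi : config L S) w : restr L (splice xi w) = xi.
Proof.
by apply/funext => u; rewrite /restr splice_in; [exact: fsvalP|move=> h;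
  congr xi; exact: val_inj].
Qed.

Lemma agree_off_sub B L w w' : (B `<=` L)%fset -> agree_off B w w' -> agree_off
  L w w'.
Proof. by move=> BL h x Lx; apply: h; apply: contra Lx;
  exact: (fsubsetP BL). Qed.

Lemma eq_splice L (xi : config L S) w w' :
  agree_off L w w' -> splice xi w = splice xi w'.
Proof.
move=> h; apply/funext => x; case: (boolP (x \in L)) => Lx;
  first by rewrite !splice_in.
by rewrite !splice_out// h.
Qed.

Lemma splice_restr_id L w w' : agree_off L w w' -> splice (restr L w) w' = w.
Proof. by move=> h; apply/funext => x; rewrite splice_restr;
  case: ifPn => // Lx; rewrite h. Qed.

End splice_theory.

Section splice_measurability.
Context {d : nat} {disp : measure_display} {S : measurableType disp}.
Implicit Types L : {fset site d}.

Lemma measurable_splice L :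
  measurable_fun setT (fun p : config L S * config (site d) S =>
    splice p.1 p.2 : config (site d) S).
Proof.
apply: measurable_fun_configP => x; case: (boolP (x \in L)) => Lx.
  rewrite (_ : (fun _ => _) = (fun w : config L S => w [` Lx]%fset) \o fst).
    by apply: measurableT_comp; [exact: measurable_coord|exact: measurable_fst].
  by apply/funext => p /=; rewrite splice_in.
rewrite (_ : (fun _ => _) = (fun w : config (site d) S => w x) \o snd).
  by apply: measurableT_comp; [exact: measurable_coord|exact: measurable_snd].
by apply/funext => p /=; rewrite splice_out.
Qed.

Lemma measurable_splicel L (w : config (site d) S) :
  measurable_fun setT (fun xi : config L S => splice xi w : config (site d) S).
Proof.
apply: (measurableT_comp (f := fun p : config L S * config (site d) S =>
  splice p.1 p.2 : config (site d) S) (g := fun xi => (xi, w))).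
  exact: measurable_splice.
by apply: measurable_fun_pair; [exact: measurable_id|exact: measurable_cst].
Qed.

Lemma measurable_restr L :
  measurable_fun setT (fun w : config (site d) S => restr L w : config L S).
Proof. by apply: measurable_fun_configP => u; exact: measurable_coord. Qed.

End splice_measurability.

Section splice_fubini.
Context {d : nat} {R : realType} {disp : measure_display}.
Context {S : measurableType disp} (nu : {finite_measure set S -> \bar R}).
Notation cm L := (config_measure nu L).
Implicit Types (B L M : {fset site d}) (w : site d -> S).

Lemma config_measure_boxE (L : {fset site d}) (Bx : site d -> set S) :
  (forall x, measurable (Bx x)) ->
  cm L [set w : config L S | forall u, Bx (val u) (w u)] = \prod_(x <- L)
    nu (Bx x).
Proof. by move=> mB; rewrite big_seq_fsetE;
  exact: (config_measure_box nu (B := fun u : L => Bx (val u))). Qed.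

(** Tonelli's theorem, once the reference measure on [M] is seen to be the image of the product of
    those on [M \ B] and [B] under pasting. That is checked on boxes. *)
Lemma config_measure_splice B M (F : config (site d) S -> \bar R) w :
  (B `<=` M)%fset -> measurable_fun setT F -> (forall w', 0 <= F w') ->
  \int[cm M]_xi F (splice xi w) =
  \int[cm (M `\` B)%fset]_eta \int[cm B]_xi F (splice xi (splice eta w)).
Proof.
move=> BM mF F0; pose D := (M `\` B)%fset.
pose phi (p : config D S * config B S) : config M S :=
  restr M (splice p.2 (splice p.1 w)).
have mphi0 : measurable_fun setT (fun p : config D S * config B S =>
    splice p.2 (splice p.1 w) : config (site d) S).
  apply: (measurableT_comp (f := fun p : config B S * config (site d) S =>
    splice p.1 p.2 : config (site d) S) (g := fun p => (p.2, splice p.1 w))).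
    exact: measurable_splice.
  apply: measurable_fun_pair; first exact: measurable_snd.
  by apply: (measurableT_comp (f := fun xi : config D S => splice xi w :
    config (site d) S)); [exact: measurable_splicel|exact: measurable_fst].
have mphi : measurable_fun setT phi.
  by apply: (measurableT_comp (f := fun w' : config (site d) S => restr M w' :
    config M S)); [exact: measurable_restr|exact: mphi0].
have [m mE] := pushforward_measureP (cm D \x cm B)%E mphi.
have mcm A : measurable A -> cm M A = m A.
  apply: config_measure_unique.
    by rewrite -ge0_fin_numE//; exact: (@fin_num_measure _ _ _ (cm M)).
  move=> Bu mBu; rewrite mE /pushforward.
  (* Indexing the box by all sites lets the same family describe its traces on [M], [B] and
     [M \ B]. *)
  pose Bx x := if insub x is Some u then Bu u else setT.
  have mBx x : measurable (Bx x) by rewrite /Bx; case: insubP.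
  have BuE u : Bu u = Bx (val u) by rewrite /Bx valK.
  under eq_set do under eq_forall do rewrite BuE.
  transitivity ((cm D \x cm B) ([set e : config D S | forall u,
    Bx (val u) (e u)] `*`
        [set e : config B S | forall u, Bx (val u) (e u)])).
    have mbox (L : {fset site d}) :
        measurable [set e : config L S | forall u, Bx (val u) (e u)].
      exact: (measurable_box (B := fun u : L => Bx (val u))).
    rewrite product_measure1E; [|exact: mbox|exact: mbox].
    have bE (L : {fset site d}) := @config_measure_boxE L _ mBx.
    transitivity (\prod_(x <- M) nu (Bx x)); first exact: bE.
    transitivity ((\prod_(x <- D) nu (Bx x)) * \prod_(x <- B) nu (Bx x));
      last first.
      by congr (_ * _); apply/esym; exact: bE.
    rewrite muleC (big_fsetID _ (mem B)) /=; congr (_ * _).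
      apply: eq_fbigl => x; rewrite !inE /=.
      by case: (boolP (x \in B)) => [/(fsubsetP BM) ->|]; rewrite ?andbF.
    by apply: eq_fbigl => x; rewrite !inE /= andbC.
  congr ((cm D \x cm B) _); apply/seteqP; split=>
    [[e x] /= [he hx] u|[e x] /= h].
    rewrite /phi /restr /=; case: (boolP (val u \in B)) => uB.
      by rewrite splice_in; exact: (hx [` uB]%fset).
    have uD : val u \in D by rewrite !inE uB fsvalP.
    by rewrite splice_out// splice_in; exact: (he [` uD]%fset).
  split=> u.
    have uD : val u \in D := fsvalP u.
    have /andP[uB uM] : (val u \notin B) && (val u \in M) by move: uD;
      rewrite inE.
    have := h [` uM]%fset; rewrite /phi /restr /= splice_out// (splice_in _ _
      uD).
    by congr (Bx _ (e _)); exact: val_inj.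
  have uB := fsvalP u; have uM := fsubsetP BM _ uB.
  have := h [` uM]%fset; rewrite /phi /restr /= (splice_in _ _ uB).
  by congr (Bx _ (x _)); exact: val_inj.
rewrite (eq_measure_integral m); last by move=> A mA _; exact: mcm.
have mFw : measurable_fun setT (fun xi : config M S => F (splice xi w)).
  exact: (measurableT_comp mF (measurable_splicel w)).
rewrite mE ge0_integral_pushforward//.
rewrite preimage_setT.
transitivity (\int[cm D \x cm B]_p F (splice p.2 (splice p.1 w))).
  apply: eq_integral => p _ /=; congr F; apply: splice_restr_id => x xM.
  rewrite !splice_out//; last by apply: contra xM; exact: (fsubsetP BM).
  by rewrite inE (negbTE xM) andbF.
have mFp : measurable_fun setT (fun p : config D S * config B S =>
    F (splice p.2 (splice p.1 w))) by exact: (measurableT_comp mF mphi0).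
by rewrite fubini_tonelli1.
Qed.

End splice_fubini.

(** * Additivity of the energy *)

Section neighbors.
Context {d : nat}.
Implicit Types (x y : site d) (L : {fset site d}).

Lemma nn_sym x y : nn x y = nn y x.
Proof. by rewrite /nn; congr (_ == _); apply: eq_bigr => i _;
  rewrite distrC. Qed.

Lemma nnxx x : nn x x = false.
Proof. by rewrite /nn big1// => i _; rewrite subrr normr0. Qed.

Lemma neighborhoodP L : exists T : {fset site d},
  (L `<=` T)%fset /\ forall x y, x \in L -> nn x y -> y \in T.
Proof.
(* The value [f i] in 0, 1, 2 encodes the displacement [f i - 1], so these points fill the sup-norm
   ball of radius 1 around [x]. *)
pose shift x (f : {ffun 'I_d -> 'I_3}) : site d :=
  (\row_i (x ord0 i + (f i : nat)%:Z - 1))%R.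
exists (L `|` \bigcup_(x <- L) [fset shift x f | f in {: {ffun 'I_d ->
  'I_3}}])%fset.
split; first exact: fsubsetUl.
move=> x y Lx xy; rewrite inE; apply/orP; right; apply/bigfcupP.
exists x; first by rewrite Lx.
have bnd i : (`|y ord0 i - x ord0 i| <= 1)%R.
  move: xy; rewrite nn_sym => /eqP <-.
  rewrite (bigD1 i)//= lerDl; apply: sumr_ge0 => j _; exact: normr_ge0.
apply/imfsetP => /=.
exists [ffun i => inord `|(y ord0 i - x ord0 i + 1)%R|%N] => //.
apply/rowP => i; rewrite mxE ffunE inordK.
  have := bnd i; rewrite ler_norml => /andP[h _].
  rewrite gez0_abs; last by rewrite -lerBlDr sub0r.
  by rewrite -addrA addrK addrC subrK.
have := bnd i; rewrite ler_norml => /andP[h h'].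
rewrite -ltz_nat gez0_abs; last by rewrite -lerBlDr sub0r.
by rewrite -ltrBrDr (le_lt_trans h').
Qed.

End neighbors.

Lemma measurable_expeR (R : realType) : measurable_fun setT (@expeR R).
Proof.
rewrite (_ : expeR = fun x => if x == -oo then 0 else
  if x == +oo then +oo else (expR (fine x))%:E); last first.
  by apply/funext => -[].
apply: measurable_fun_ifT => //; first exact: measurable_fun_eqe.
apply: measurable_fun_ifT => //; first exact: measurable_fun_eqe.
by apply/measurable_EFinP; apply: measurableT_comp.
Qed.

Section energy.
Context {d : nat} {R : realType} {disp : measure_display}.
Context {S : measurableType disp} (X : interaction R S) (hX :
  is_spin_system d X).
Implicit Types (B L M T : {fset site d}) (w : site d -> S).
Notation U := (pairU X).
Notation W := (siteW X).

Lemma pairU_lty a b : U a b < +oo.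
Proof.
case: (pairU_values _ hX) => [[K h]|[_ h _ _]]; last exact: h.
by apply: le_lt_trans (lee_abs _) _; apply: le_lt_trans (h a b) _; rewrite ltry.
Qed.

(** One-sided because of hard constraints. For finite [S] the sum of all [|fine (U a b)|] is a
    bound: the value [-oo] contributes zero to it and lies below it anyway. *)
Lemma pairU_ub : exists2 K : R, (0 <= K)%R & forall a b, U a b <= K%:E.
Proof.
case: (pairU_values _ hX) => [[K h]|[[fS _] h _ _]].
  exists K => [|a b].
    by rewrite -lee_fin; apply: le_trans (h point point); exact: abse_ge0.
  exact: le_trans (lee_abs _) (h a b).
have [s sE] := (finite_seqP _).1 fS.
exists (\sum_(a <- s) \sum_(b <- s) `|fine (U a b)|)%R.
  by apply: sumr_ge0 => a _; apply: sumr_ge0.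
move=> a b.
have sa c : c \in s by have : [set` s] c by rewrite -sE.
have Uf : U a b <= `|fine (U a b)|%:E.
  by case: (U a b) (h a b) => [r _|//|_]; rewrite ?leNye// lee_fin ler_norm.
apply: (le_trans Uf); rewrite lee_fin (big_rem a)//= (big_rem b)//= -addrA
  lerDl.
by rewrite addr_ge0//; apply: sumr_ge0 => *//; apply: sumr_ge0.
Qed.

Definition oriented (x y : site d) := nn x y && (choice.pickle x < choice.pickle
  y)%N.

(** Writing [- hamiltonian L] as a sum over the edges that touch [L], inside a
    fixed finite set [T], makes it additive in the set of edges. *)
Definition touching_energy T (c : site d -> site d -> bool) (c' :
  site d -> bool) w : \bar R :=
  \sum_(x <- T) \sum_(y <- T) (if oriented x y && c x y then U (w x) (w y)
    else 0)
  + (\sum_(x <- T) (if c' x then W (w x) else 0))%R%:E.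

Lemma hamiltonianE L T w : (L `<=` T)%fset ->
  (forall x y, x \in L -> nn x y -> y \in T) ->
  - hamiltonian X L w =
  touching_energy T (fun x y => (x \in L) || (y \in L)) (mem L) w.
Proof.
move=> LT nT.
have sub (F : site d -> \bar R) : \sum_(x <- L) F x = \sum_(x <- T)
  if x \in L then F x else 0.
  rewrite -big_mkcond [RHS]big_fset_condE; apply: eq_fbigl => x.
  rewrite !inE /=; case: (boolP (x \in L)) => [/(fsubsetP LT) ->|]//.
  by rewrite andbF.
have subR (F : site d -> R) : (\sum_(x <- L) F x = \sum_(x <- T)
  if x \in L then F x else 0)%R.
  rewrite -big_mkcond [RHS]big_fset_condE; apply: eq_fbigl => x.
  rewrite !inE /=; case: (boolP (x \in L)) => [/(fsubsetP LT) ->|]//.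
  by rewrite andbF.
rewrite /hamiltonian /touching_energy.
set E1 := (X in - X - _ - _); set E2 := (X in _ - X - _).
have E1y : E1 < +oo.
  apply: lte_sum_pinfty => x _; apply: lte_sum_pinfty => y _; exact: pairU_lty.
have E2E : E2 = \sum_(x <- T) \sum_(y <- T)
    if [&& x \in L, y \notin L & nn x y] then U (w x) (w y) else 0.
  rewrite /E2 sub; apply: eq_bigr => x _; case: ifPn => Lx;
    last by rewrite big1.
  rewrite -big_mkcond [RHS]big_fset_condE [RHS]fsbig_seq//.
  apply: eq_fsbigl; apply/seteqP; split=> y /=; rewrite !inE /=.
    move=> [[yL _] xy]; apply/andP; split; first exact: nT xy.
    by apply/andP.
  by move=> /andP[_ /andP[yL xy]]; split=> //; split=> //; exists x.
have E2y : E2 < +oo.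
  rewrite E2E; apply: lte_sum_pinfty => x _; apply: lte_sum_pinfty => y _.
  by case: ifP => _; [exact: pairU_lty|exact: ltry].
(* Distributing the opposite over the sum is legitimate because [E1] and [E2] may be [-oo] but never
   [+oo]. *)
transitivity (E1 + E2 + (\sum_(x <- L) W (w x))%R%:E).
  by move: E1 E2 E1y E2y {E2E} => [a| |] [b| |]//= _ _;
  rewrite -!EFinD; congr EFin; ring.
rewrite subR; congr (_ + _).
(* A boundary edge is listed in the Hamiltonian from its endpoint in [L], which may be either end in
   the [pickle] orientation. Symmetry of [U] turns the second case into an oriented sum with the
   roles exchanged. *)
have -> : E2 = \sum_(x <- T) \sum_(y <- T)
    (if oriented x y && ((x \in L) && (y \notin L)) then U (w x) (w y) else 0) +
    \sum_(x <- T) \sum_(y <- T)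
    (if oriented x y && ((x \notin L) && (y \in L)) then U (w x) (w y) else 0).
  rewrite [X in _ = _ + X]exchange_big /= -big_split /= E2E;
    apply: eq_bigr => x _.
  rewrite -big_split /=; apply: eq_bigr => y _.
  rewrite /oriented (nn_sym y x) (pairU_sym _ hX (w y)).
  case: (boolP (nn x y)) => [xy|]; last by rewrite !andbF adde0.
  have : choice.pickle x != choice.pickle y.
    by apply/eqP => /(pcan_inj choice.pickleK) exy; move: xy; rewrite exy nnxx.
  by case: ltngtP; case: (x \in L); case: (y \in L) => //=;
    rewrite ?adde0 ?add0e.
rewrite /E1 sub -!big_split /=; apply: eq_bigr => x _.
rewrite (_ : (if x \in L then _ else 0) = \sum_(y <- T)
    if (x \in L) && ((y \in L) && oriented x y) then U (w x) (w y) else 0).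
  rewrite -!big_split /=; apply: eq_bigr => y _.
  by case: (x \in L); case: (y \in L); case: (oriented x y) => //=;
    rewrite ?adde0 ?add0e.
case: ifPn => Lx; last by rewrite big1.
rewrite big_mkcond sub; apply: eq_bigr => y _.
by rewrite -/(oriented x y); case: (y \in L); case: oriented.
Qed.

Lemma touching_energyD T c1 c1' c2 c2' c c' w :
  (forall x y, c x y = c1 x y || c2 x y) -> (forall x, c' x = c1' x || c2' x) ->
  (forall x y, c1 x y -> c2 x y = false) -> (forall x,
    c1' x -> c2' x = false) ->
  touching_energy T c c' w = touching_energy T c1 c1' w + touching_energy T c2
    c2' w.
Proof.
move=> cE c'E d1 d2; rewrite /touching_energy addeACA -EFinD -!big_split /=.
congr (_ + _%:E).
  apply: eq_bigr => x _; rewrite -big_split /=; apply: eq_bigr => y _;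
    rewrite cE.
  by case: (boolP (c1 x y)) => [/d1 ->|_]; case: oriented;
    rewrite /= ?adde0 ?add0e.
apply: eq_bigr => x _; rewrite c'E.
by case: (boolP (c1' x)) => [/d2 ->|_]; rewrite /= ?addr0 ?add0r.
Qed.

Lemma measurable_touching_energy T c c' :
  measurable_fun setT (fun w : config (site d) S => touching_energy T c c' w).
Proof.
apply: emeasurable_funD.
  apply: emeasurable_sum => x; apply: emeasurable_sum => y.
  case: (oriented x y && c x y); last exact: measurable_cst.
  apply: (measurableT_comp (pairU_measurable _ hX) (g := fun w :
    config (site d) S => (w x, w y))).
  by apply: measurable_fun_pair; exact: measurable_coord.
apply/measurable_EFinP; apply: measurable_sum => x.
case: (c' x); last exact: measurable_cst.
exact: (measurableT_comp (siteW_measurable _ hX) (measurable_coord x)).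
Qed.

Lemma touching_energy_ub T c c' : exists C :
  R, forall w, touching_energy T c c' w <= C%:E.
Proof.
have [K K0 UK] := pairU_ub; have [K' WK] := siteW_bounded _ hX.
have K'0 : (0 <= K')%R by apply: le_trans (WK point).
exists (\sum_(x <- T) \sum_(y <- T) K + \sum_(x <- T) K')%R => w.
rewrite EFinD leeD//.
  rewrite -sumEFin; apply: lee_sum => x _; rewrite -sumEFin;
    apply: lee_sum => y _.
  by case: ifP => _; rewrite ?lee_fin.
rewrite lee_fin; apply: ler_sum => x _; case: ifP => // _.
exact: le_trans (ler_norm _) (WK _).
Qed.

Lemma touching_energy_lb T c c' : (exists K :
  R, forall a b, `|U a b| <= K%:E) ->
  exists C : R, forall w, C%:E <= touching_energy T c c' w.
Proof.
move=> [K UK]; have [K' WK] := siteW_bounded _ hX.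
have K'0 : (0 <= K')%R by apply: le_trans (WK point).
have K0 : (0 <= K)%R by rewrite -lee_fin;
  exact: le_trans (abse_ge0 _) (UK point point).
exists (\sum_(x <- T) \sum_(y <- T) - K + \sum_(x <- T) - K')%R => w.
rewrite EFinD leeD//.
  rewrite -sumEFin; apply: lee_sum => x _; rewrite -sumEFin;
    apply: lee_sum => y _.
  case: ifP => _; last by rewrite lee_fin oppr_le0.
  by rewrite EFinN leeNl; apply: le_trans (lee_abs _) _; rewrite abseN.
rewrite lee_fin; apply: ler_sum => x _; case: ifP => // _;
  last by rewrite oppr_le0.
by have := WK (w x); rewrite ler_norml => /andP[].
Qed.

Definition weight L w : \bar R := expeR (- hamiltonian X L w).

Lemma weight_ge0 L w : 0 <= weight L w.
Proof. exact: expeR_ge0. Qed.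

Lemma measurable_weight L : measurable_fun setT (fun w :
  config (site d) S => weight L w).
Proof.
have [T [LT nT]] := neighborhoodP L.
apply: (measurableT_comp (@measurable_expeR R)).
rewrite (_ : (fun _ => _) = touching_energy T (fun x y =>
  (x \in L) || (y \in L)) (mem L)).
  exact: measurable_touching_energy.
by apply/funext => w; exact: hamiltonianE.
Qed.

Lemma weight_ub L : exists2 C : R, (0 <= C)%R & forall w, weight L w <= C%:E.
Proof.
have [T [LT nT]] := neighborhoodP L.
have [C h] := touching_energy_ub T (fun x y => (x \in L) || (y \in L)) (mem L).
exists (expR C); first exact: expR_ge0.
by move=> w; rewrite /weight (hamiltonianE _ LT nT) -[_%:E]/(expeR C%:E)
  lee_expeR.
Qed.

Lemma weight_lb L : (exists K : R, forall a b, `|U a b| <= K%:E) ->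
  exists2 C : R, (0 < C)%R & forall w, C%:E <= weight L w.
Proof.
move=> bU; have [T [LT nT]] := neighborhoodP L.
have [C h] := touching_energy_lb T (fun x y =>
  (x \in L) || (y \in L)) (mem L) bU.
exists (expR C); first exact: expR_gt0.
by move=> w; rewrite /weight (hamiltonianE _ LT nT) -[_%:E]/(expeR C%:E)
  lee_expeR.
Qed.

(** [G] is the exponential of the energy of the edges and sites that touch [M] but not [B], hence
    blind to the spins in [B]. The multiplicative form survives hard constraints, where the weight
    is zero. Consistency of the Gibbs measures rests on this factorization. *)
Lemma weight_split B M : (B `<=` M)%fset ->
  exists G : config (site d) S -> \bar R, [/\ measurable_fun setT G,
    (forall w, 0 <= G w),
    (forall w w', agree_off B w w' -> G w = G w') &
    forall w, weight M w = weight B w * G w].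
Proof.
move=> BM; have [T [MT nT]] := neighborhoodP M.
have BT := fsubset_trans BM MT.
have nBT x y : x \in B -> nn x y -> y \in T by move=> /(fsubsetP BM); exact: nT.
pose c x y := ((x \in M) || (y \in M)) && ~~ ((x \in B) || (y \in B)).
pose c' x := (x \in M) && (x \notin B).
exists (fun w => expeR (touching_energy T c c' w)); split.
- exact: (measurableT_comp (@measurable_expeR R)
    (measurable_touching_energy T c c')).
- by move=> w; exact: expeR_ge0.
- move=> w w' ww'; congr expeR; congr (_ + _%:E).
    apply: eq_bigr => x _; apply: eq_bigr => y _; case: ifP => //.
    by move=> /and3P[_ _]; rewrite negb_or => /andP[xB yB]; rewrite !ww'.
  by apply: eq_bigr => x _; case: ifP => // /andP[_ xB]; rewrite ww'.
- move=> w; rewrite /weight (hamiltonianE _ MT nT) (hamiltonianE _ BT nBT)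
    -expeRD.
  congr expeR; apply: touching_energyD.
  + move=> x y; rewrite /c; case: (boolP (x \in B)) => [/(fsubsetP BM) ->//|_].
    by case: (boolP (y \in B)) => [/(fsubsetP BM) ->|_]; rewrite ?orbT ?andbT.
  + by move=> x; rewrite /c' /=; case: (boolP (x \in B)) =>
      [/(fsubsetP BM) ->//|_]; rewrite andbT.
  + by move=> x y; rewrite /c => ->; rewrite andbF.
  + by move=> x; rewrite /c' /= => ->; rewrite andbF.
Qed.

End energy.

(** * Integration against a measure given by a density *)

Section density.
Context d (T : measurableType d) (R : realType).
Variables (mu m : {measure set T -> \bar R}) (f : T -> R).
Hypotheses (mf : measurable_fun setT f) (f0 : forall x, (0 <= f x)%R).
Hypothesis mE : forall A, measurable A -> m A = \int[mu]_(x in A) (f x)%:E.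

Import HBNNSimple.

Let density_simple (h : {nnsfun T >-> R}) :
  \int[m]_x (h x)%:E = \int[mu]_x ((f x)%:E * (h x)%:E).
Proof.
rewrite integralT_nnsfun sintegralE.
under [RHS]eq_integral => x _.
  rewrite -EFinM fimfunE fsbig_finite//= mulr_sumr -sumEFin.
  over.
have mterm (r : R) : measurable_fun setT (fun x =>
  f x * (r * \1_(h @^-1` [set r]) x))%R.
  apply: measurable_funM => //; apply: measurable_funM;
    first exact: measurable_cst.
  exact: measurable_indic.
rewrite ge0_integral_sum//=; last 2 first.
- by move=> r; apply/measurable_EFinP.
- move=> r x _; rewrite lee_fin mulr_ge0//.
  exact: (nnfun_muleindic_ge0 h).
rewrite -fsbig_finite//; apply: eq_fsbigr => r /[!inE] -[x _ <-].
rewrite mE//.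
transitivity (\int[mu]_y ((h x)%:E * (f y * \1_(h @^-1` [set h x]) y)%:E));
  last first.
  by apply: eq_integral => y _; rewrite -EFinM mulrCA.
rewrite ge0_integralZl_EFin//; last 2 first.
- by move=> y _; rewrite lee_fin mulr_ge0// indicE ler0n.
- apply/measurable_EFinP; exact: measurable_funM.
congr (_ * _); rewrite integral_mkcond epatch_indic.
by apply: eq_integral => y _; rewrite EFinM.
Qed.

Lemma ge0_integral_density (g : T -> \bar R) :
  measurable_fun setT g -> (forall x, 0 <= g x) ->
  \int[m]_x g x = \int[mu]_x ((f x)%:E * g x).
Proof.
move=> mg g0; pose g_ := nnsfun_approx measurableT mg.
have cvg_g x : (g_ n x)%:E @[n --> \oo] --> g x by exact: cvg_nnsfun_approx.
transitivity (limn (fun n => \int[m]_x (g_ n x)%:E)).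
  rewrite -monotone_convergence//=.
  - by apply: eq_integral => x _; apply/esym/cvg_lim.
  - by move=> n; exact/measurable_EFinP.
  - by move=> n x _; rewrite lee_fin.
  - by move=> x _ a b ab; rewrite lee_fin//; exact/lefP/nd_nnsfun_approx.
rewrite (_ : (fun n => _) = fun n => \int[mu]_x ((f x)%:E * (g_ n x)%:E));
  last first.
  by apply/funext => n; rewrite density_simple.
rewrite -monotone_convergence//=.
- by apply: eq_integral => x _; apply/cvg_lim => //; apply: cvgeZl.
- by move=> n; apply: emeasurable_funM; exact/measurable_EFinP.
- by move=> n x _; rewrite mule_ge0// lee_fin.
- move=> x _ a b ab; rewrite lee_wpmul2l// lee_fin//;
    exact/lefP/nd_nnsfun_approx.
Qed.

End density.

(** * Gibbs measures and their consistency *)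

Section gibbs_measure.
Context {d : nat} {R : realType} {disp : measure_display}.
Context {S : measurableType disp} (X : interaction R S) (hX :
  is_spin_system d X).
Implicit Types (B L M : {fset site d}) (w : site d -> S).
Notation U := (pairU X).
Notation cm L := (config_measure (base X) L).

Lemma base_gt0 : 0 < base X setT.
Proof.
case: (base_prob _ hX) => [->|[_ ->]]; first by rewrite lte01.
rewrite /counting; case: asboolP => // fS; rewrite lte_fin ltr0n cardfs_gt0.
by apply/fset0Pn; exists point; rewrite in_fset_set// inE.
Qed.

Lemma config_measure_gt0 L : 0 < cm L setT.
Proof.
have -> : cm L setT = \prod_(u : L) base X setT.
  rewrite -(@config_measure_box _ _ _ (base X) L (fun=> setT))//.
  by congr (cm L _); apply/seteqP.
elim/big_ind: _ => [|x y|_ _]; first by rewrite lte01.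
- exact: mule_gt0.
- exact: base_gt0.
Qed.

Lemma partition_funE L w : partition_fun X L w = \int[cm L]_xi weight X L
  (splice xi w).
Proof. by []. Qed.

Lemma measurable_weightl L w :
  measurable_fun setT (fun xi : config L S => weight X L (splice xi w)).
Proof. exact: (measurableT_comp (measurable_weight hX L)
  (measurable_splicel w)). Qed.

Lemma weight_fin L w : weight X L w \is a fin_num.
Proof.
have [C _ h] := weight_ub hX L.
by rewrite ge0_fin_numE ?weight_ge0// (le_lt_trans (h w))// ltry.
Qed.

Lemma partition_fun_lty L w : partition_fun X L w < +oo.
Proof.
have [C C0 h] := weight_ub hX L.
apply: (@le_lt_trans _ _ (\int[cm L]_xi C%:E)).
  apply: ge0_le_integral => //.
  - by move=> xi _; exact: weight_ge0.
  - exact: measurable_weightl.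
  - by move=> xi _; exact: h.
rewrite integral_cst// lte_mul_pinfty ?lee_fin//.
by rewrite -ge0_fin_numE//; exact: (@fin_num_measure _ _ _ (cm L)).
Qed.

Lemma partition_fun_gt0 L w : 0 < partition_fun X L w.
Proof.
case: (pairU_values _ hX) => [bU|[_ _ perm _]].
  have [C C0 h] := weight_lb hX L bU.
  apply: (@lt_le_trans _ _ (\int[cm L]_xi C%:E)).
    by rewrite integral_cst// mule_gt0 ?lte_fin// config_measure_gt0.
  apply: ge0_le_integral => //.
  - by move=> xi _; rewrite lee_fin ltW.
  - exact: measurable_weightl.
  - by move=> xi _; exact: h.
(* If the partition function were zero, its inverse would be zero as well and so would every value
   of [gibbs], against permissivity. *)
have [sigma] := perm L w; rewrite lt_neqAle => /andP[+ _].
rewrite lt_neqAle; apply: contraNT; rewrite negb_and negbK => /orP[/eqP Z0|].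
  by rewrite /gibbs -Z0 /= invr0 mul0e.
by rewrite integral_ge0// => xi _; exact: weight_ge0.
Qed.

Lemma partition_fun_fin L w : partition_fun X L w \is a fin_num.
Proof. by rewrite ge0_fin_numE ?partition_fun_lty// ltW// partition_fun_gt0.
  Qed.

Lemma fine_partition_fun_gt0 L w : (0 < fine (partition_fun X L w))%R.
Proof. by rewrite fine_gt0// partition_fun_gt0 partition_fun_lty. Qed.

Definition gibbs_density L w (xi : config L S) : R :=
  ((fine (partition_fun X L w))^-1 * fine (weight X L (splice xi w)))%R.

Lemma gibbs_density_ge0 L w xi : (0 <= @gibbs_density L w xi)%R.
Proof.
apply: mulr_ge0; first by rewrite invr_ge0 ltW// fine_partition_fun_gt0.
by apply: fine_ge0; exact: weight_ge0.
Qed.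

Lemma measurable_gibbs_density L w : measurable_fun setT (@gibbs_density L w).
Proof.
apply: measurable_funM; first exact: measurable_cst.
by apply: (measurableT_comp (@fine_measurable R _ measurableT));
  exact: measurable_weightl.
Qed.

Lemma gibbsE L w A : measurable A ->
  gibbs X L w A = \int[cm L]_(xi in A) (gibbs_density w xi)%:E.
Proof.
move=> mA; rewrite /gibbs -ge0_integralZl//; last 3 first.
- by apply: measurable_funTS; exact: measurable_weightl.
- by move=> xi _; exact: weight_ge0.
- by rewrite lee_fin invr_ge0 ltW// fine_partition_fun_gt0.
by apply: eq_integral => xi _; rewrite EFinM fineK ?weight_fin.
Qed.

Section instances.
Variables (L : {fset site d}) (w : site d -> S).
Notation g := (gibbs X L w).

Lemma gibbs0 : g set0 = 0.
Proof. by rewrite /gibbs integral_set0 mule0. Qed.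

Lemma gibbs_ge0 A : 0 <= g A.
Proof.
apply: mule_ge0; first by rewrite lee_fin invr_ge0 ltW// fine_partition_fun_gt0.
by apply: integral_ge0 => xi _; exact: weight_ge0.
Qed.

Lemma gibbs_sigma_additive : semi_sigma_additive g.
Proof.
move=> F mF tF mUF; rewrite gibbsE//.
rewrite [X in X @ _ --> _](_ : _ = (fun n =>
    \sum_(0 <= i < n) \int[cm L]_(xi in F i) (gibbs_density w xi)%:E));
      last first.
  by apply/funext => n; apply: eq_bigr => i _; rewrite gibbsE.
apply: semi_sigma_additive_nng_induced => //.
- by apply/measurable_EFinP; exact: measurable_gibbs_density.
- by move=> xi; rewrite lee_fin gibbs_density_ge0.
Qed.

HB.instance Definition _ := isMeasure.Build _ _ _ g gibbs0 gibbs_ge0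
  gibbs_sigma_additive.

Lemma gibbsT : g setT = 1.
Proof.
rewrite /gibbs -partition_funE -[X in _ * X]fineK ?partition_fun_fin// -EFinM.
by rewrite mulVf// gt_eqF// fine_partition_fun_gt0.
Qed.

HB.instance Definition _ := Measure_isProbability.Build _ _ _ g gibbsT.

Definition gibbs_prob : probability (config L S) R := g.

Lemma ge0_integral_gibbs (F : config L S -> \bar R) :
  measurable_fun setT F -> (forall xi, 0 <= F xi) ->
  \int[gibbs X L w]_xi F xi = \int[cm L]_xi ((gibbs_density w xi)%:E * F xi).
Proof.
move=> mF F0; apply: ge0_integral_density => //.
- exact: measurable_gibbs_density.
- exact: gibbs_density_ge0.
- exact: gibbsE.
Qed.

End instances.

Definition gexpect B (F : config (site d) S -> \bar R) w : \bar R :=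
  \int[gibbs X B w]_xi F (splice xi w).

Lemma eq_gibbs B w w' : agree_off B w w' -> gibbs X B w = gibbs X B w'.
Proof.
move=> h; have e : boltzmann X B w = boltzmann X B w'.
  by apply/funext => xi; rewrite /boltzmann (eq_splice xi h).
by apply/funext => A; rewrite /gibbs /partition_fun e.
Qed.

Lemma eq_gexpect B F w w' : agree_off B w w' -> gexpect B F w = gexpect B F w'.
Proof.
by move=> h; rewrite /gexpect (eq_gibbs h); apply: eq_integral => xi _;
  rewrite (eq_splice _ h).
Qed.

Section nonneg.
Variables (F : config (site d) S -> \bar R).
Hypotheses (mF : measurable_fun setT F) (F0 : forall w, 0 <= F w).

Lemma gexpectE B w : gexpect B F w = ((fine (partition_fun X B w))^-1)%:E *
  \int[cm B]_xi (weight X B (splice xi w) * F (splice xi w)).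
Proof.
have mFw : measurable_fun setT (fun xi : config B S => F (splice xi w)).
  exact: (measurableT_comp mF (measurable_splicel w)).
rewrite /gexpect ge0_integral_gibbs// -ge0_integralZl//; last 3 first.
- by apply: emeasurable_funM => //; exact: measurable_weightl.
- by move=> xi _; rewrite mule_ge0// weight_ge0.
- by rewrite lee_fin invr_ge0 ltW// fine_partition_fun_gt0.
by apply: eq_integral => xi _; rewrite EFinM fineK ?weight_fin// muleA.
Qed.

Lemma gexpect_ge0 B w : 0 <= gexpect B F w.
Proof. by apply: integral_ge0 => xi _. Qed.

Lemma measurable_integral_splice B :
  measurable_fun setT (fun w : config (site d) S =>
    \int[cm B]_xi F (splice xi w)).
Proof.
have := @measurable_fun_fubini_tonelli_F _ _ _ _ _ (cm B)
  (fun p : config (site d) S * config B S => F (splice p.2 p.1)).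
apply => [|p]; last exact: F0.
apply: (measurableT_comp mF).
apply: (measurableT_comp (f := fun p : config B S * config (site d) S =>
  splice p.1 p.2 : config (site d) S) (g := fun p => (p.2, p.1))).
  exact: measurable_splice.
by apply: measurable_fun_pair; [exact: measurable_snd|exact: measurable_fst].
Qed.

End nonneg.

Lemma measurable_gexpect B (F : config (site d) S -> \bar R) :
  measurable_fun setT F -> (forall w, 0 <= F w) ->
  measurable_fun setT (gexpect B F : config (site d) S -> \bar R).
Proof.
move=> mF F0.
have w0 := @weight_ge0 _ _ _ _ X B; have mw := measurable_weight hX B.
(* The inverse of the positive partition function is written as [expR (- ln _)], so that
   measurability follows by composition. *)
rewrite (_ : gexpect B F = fun w : config (site d) S =>
  (expR (- ln (fine (\int[cm B]_xi weight X B (splice xi w)))))%:E *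
  \int[cm B]_xi (weight X B (splice xi w) * F (splice xi w))); last first.
  apply/funext => w; rewrite gexpectE//; congr (_%:E * _).
  by rewrite expRN lnK// posrE; exact: fine_partition_fun_gt0.
apply: emeasurable_funM; last first.
  apply: (measurable_integral_splice (F := fun w => weight X B w * F w)).
    exact: emeasurable_funM.
  by move=> w; rewrite mule_ge0.
apply/measurable_EFinP; apply: (measurableT_comp (@measurable_expR R)).
apply: measurable_funN; apply: (measurableT_comp (@measurable_ln R)).
apply: (measurableT_comp (@fine_measurable R _ measurableT)).
exact: (measurable_integral_splice (F := weight X B)).
Qed.

(** Consistency of the specification (DLR). After Tonelli and [weight_split], both [G] and
    [gexpect B F] are constant in the inner integral over [B]; the remaining integral of
    [weight X B] is the partition function that normalizes [gexpect B F]. *)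
Lemma gexpect_tower B M (F : config (site d) S -> \bar R) w :
  (B `<=` M)%fset -> measurable_fun setT F -> (forall w, 0 <= F w) ->
  gexpect M (gexpect B F) w = gexpect M F w.
Proof.
move=> BM mF F0.
have mTF := measurable_gexpect B mF F0.
have TF0 w' : 0 <= gexpect B F w' by exact: gexpect_ge0.
rewrite (gexpectE mTF TF0) (gexpectE mF F0); congr (_ * _).
have [G [mG G0 Goff GE]] := weight_split hX BM.
have w0 := @weight_ge0 _ _ _ _ X; have mw := measurable_weight hX.
rewrite (config_measure_splice _ _ BM (F := fun w =>
  weight X M w * gexpect B F w)); last 2 first.
- exact: emeasurable_funM.
- by move=> w'; rewrite mule_ge0.
rewrite (config_measure_splice _ _ BM (F := fun w => weight X M w * F w));
  last 2 first.
- exact: emeasurable_funM.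
- by move=> w'; rewrite mule_ge0.
apply: eq_integral => eta _; set w' := splice eta w.
have offB xi : agree_off B (@splice _ _ B xi w') w' by exact: splice_out.
have mwF : measurable_fun setT (fun xi :
  config B S => weight X B (splice xi w') * F (splice xi w')).
  apply: emeasurable_funM; first exact: measurable_weightl.
  exact: (measurableT_comp mF (measurable_splicel w')).
transitivity (\int[cm B]_xi (weight X B (splice xi w')
  * (G w' * gexpect B F w'))).
  apply: eq_integral => xi _.
  by rewrite GE (Goff _ _ (offB xi)) (eq_gexpect F (offB xi)) muleA.
rewrite ge0_integralZr//; last 2 first.
- exact: measurable_weightl.
- by rewrite mule_ge0.
transitivity (\int[cm B]_xi (weight X B (splice xi w') * F (splice xi w')
  * G w')); last first.
  apply: eq_integral => xi _.
  by rewrite GE (Goff _ _ (offB xi)) -!muleA; congr (_ * _); rewrite muleC.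
rewrite ge0_integralZr//; last by move=> xi _; rewrite mule_ge0.
rewrite gexpectE// -partition_funE -[X in X * _]fineK ?partition_fun_fin//.
rewrite muleCA [RHS]muleC; congr (G w' * _);
  rewrite muleA -EFinM divff ?mul1e//.
by rewrite gt_eqF// fine_partition_fun_gt0.
Qed.

End gibbs_measure.

(** Locked, because conversion would otherwise unfold the integrals when it
    compares expectations at two configurations. *)
Definition cexpect {d : nat} {R : realType} {disp : measure_display}
  {S : measurableType disp} (X : interaction R S) (V : {fset site d}) (tau :
    site d -> S) :=
  locked (expect X V tau).

Arguments cexpect {d R disp S} X V tau.

(** * Conditional expectations as operators on functions of the spins in [V] *)

Section expectation.
Context {d : nat} {R : realType} {disp : measure_display}.
Context {S : measurableType disp} (X : interaction R S) (hX :
  is_spin_system d X).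
Variables (V : {fset site d}) (tau : site d -> S).
Implicit Types (B L M K : {fset site d}).
Notation Omega := (config V S).
Implicit Types (sigma : Omega).

Notation P L w := (gibbs_prob hX L w).
Notation mu := (gibbs_prob hX V tau).
Notation E := (cexpect X V tau).

Lemma cexpectE : E = expect X V tau.
Proof. by rewrite /cexpect -lock. Qed.

Definition full sigma : config (site d) S := splice sigma tau.

Definition refresh L sigma (xi : config L S) :
  Omega := restr V (splice xi (full sigma)).

(** Invariance under this relation expresses that a function depends only on the spins in
    [V \ L]. *)
Definition same_off L sigma sigma' := agree_off L (full sigma) (full sigma').

Lemma same_off_sub L M sigma sigma' : (L `<=` M)%fset ->
  same_off L sigma sigma' -> same_off M sigma sigma'.
Proof. exact: agree_off_sub. Qed.

Lemma full_refresh L sigma (xi : config L S) : (L `<=` V)%fset ->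
  full (refresh sigma xi) = splice xi (full sigma).
Proof.
move=> LV; apply: splice_restr_id => x xV.
have xL : x \notin L by apply: contra xV; exact: (fsubsetP LV).
by rewrite splice_out// /full splice_out.
Qed.

Lemma same_off_refresh L sigma (xi : config L S) : (L `<=` V)%fset ->
  same_off L (refresh sigma xi) sigma.
Proof. by move=> LV; rewrite /same_off full_refresh//; exact: splice_out. Qed.

Lemma refresh_restr L sigma sigma' : same_off L sigma sigma' ->
  refresh sigma' (restr L (full sigma)) = sigma.
Proof. by move=> h; rewrite /refresh splice_restr_id// restr_splice. Qed.

Lemma measurable_full : measurable_fun setT full.
Proof. exact: measurable_splicel. Qed.

Lemma measurable_refresh L sigma :
  measurable_fun setT (fun xi : config L S => refresh sigma xi).
Proof.
exact: (measurableT_comp (f := fun w : config (site d) S => restr V w : Omega)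
  (g := fun xi : config L S => splice xi (full sigma) : config (site d) S)
  (@measurable_restr _ _ _ V) (measurable_splicel (full sigma))).
Qed.

Lemma expectE L f sigma :
  E L f sigma = \int[P L (full sigma)]_xi f (refresh sigma xi).
Proof. by rewrite cexpectE. Qed.

Lemma eq_expect L f g sigma : (forall xi,
  f (@refresh L sigma xi) = g (@refresh L sigma xi)) ->
  E L f sigma = E L g sigma.
Proof. by move=> fg; rewrite !expectE; apply: eq_integral => xi _;
  exact: fg. Qed.

Lemma expect_same_off L f sigma sigma' : same_off L sigma sigma' ->
  E L f sigma = E L f sigma'.
Proof. by move=> h; rewrite cexpectE; exact: (eq_gexpect hX (f \o restr V)
  h). Qed.

Lemma expect_refresh L M f sigma (xi : config L S) :
  (L `<=` M)%fset -> (M `<=` V)%fset ->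
  E M f (refresh sigma xi) = E M f sigma.
Proof.
move=> LM MV; apply: expect_same_off; apply: (same_off_sub LM).
exact: same_off_refresh (fsubset_trans LM MV).
Qed.

Definition nonneg_emeasurable (f : Omega -> \bar R) :=
  measurable_fun setT f /\ forall sigma, 0 <= f sigma.

Lemma measurable_refresh_comp L sigma d' (T : measurableType d') (f :
  Omega -> T) : measurable_fun setT f ->
  measurable_fun setT (fun xi : config L S => f (refresh sigma xi)).
Proof. by move=> mf; exact: (measurableT_comp mf (measurable_refresh sigma)).
  Qed.

Lemma expect_ge0 L f sigma : (forall sigma', 0 <= f sigma') -> 0 <= E L f sigma.
Proof. by move=> f0; rewrite expectE; apply: integral_ge0 => xi _;
  exact: f0. Qed.

Lemma expect_nonneg_emeasurable L f : nonneg_emeasurable f -> nonneg_emeasurable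
  (E L f).
Proof.
move=> [mf f0]; split; last by move=> sigma; exact: expect_ge0.
have mF : measurable_fun setT ((f \o restr V) : config (site d) S -> \bar R).
  exact: (measurableT_comp mf (@measurable_restr _ _ _ V)).
rewrite cexpectE.
have mg := measurable_gexpect hX L mF (fun w => f0 _).
exact: (measurableT_comp mg measurable_full).
Qed.

Lemma expect_tower L M f sigma : (L `<=` M)%fset -> (M `<=` V)%fset ->
  nonneg_emeasurable f ->
  E M (E L f) sigma = E M f sigma.
Proof.
move=> LM MV [mf f0].
have mF : measurable_fun setT ((f \o restr V) : config (site d) S -> \bar R).
  exact: (measurableT_comp mf (@measurable_restr _ _ _ V)).
transitivity (gexpect X M (gexpect X L (f \o restr V)) (full sigma));
  last first.
  by rewrite cexpectE; exact: (gexpect_tower hX _ LM mF (fun w => f0 _)).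
transitivity (\int[P M (full sigma)]_xi
  gexpect X L (f \o restr V) (splice xi (full sigma))); last first.
  reflexivity.
rewrite expectE; apply: eq_integral => xi _; rewrite cexpectE.
rewrite -(full_refresh _ _ MV). reflexivity.
Qed.

Lemma expectD L f g sigma : nonneg_emeasurable f -> nonneg_emeasurable g ->
  E L (fun s => f s + g s) sigma = E L f sigma + E L g sigma.
Proof.
move=> [mf f0] [mg g0]; rewrite !expectE ge0_integralD//;
  exact: measurable_refresh_comp.
Qed.

Lemma expect_sum L (I : Type) (r : seq I) (f : I -> Omega -> \bar R) sigma :
  (forall i, nonneg_emeasurable (f i)) ->
  E L (fun s => \sum_(i <- r) f i s) sigma = \sum_(i <- r) E L (f i) sigma.
Proof.
move=> hf; under [RHS]eq_bigr do rewrite expectE.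
rewrite expectE ge0_integral_sum//; last by move=> i xi _; have [] := hf i.
by move=> i; apply: measurable_refresh_comp; have [] := hf i.
Qed.

Lemma expectZl L (c : R) f sigma : (0 <= c)%R -> nonneg_emeasurable f ->
  E L (fun s => c%:E * f s) sigma = c%:E * E L f sigma.
Proof.
by move=> c0 [mf f0]; rewrite !expectE ge0_integralZl_EFin//;
  exact: measurable_refresh_comp.
Qed.

Lemma expect_pull L f h sigma : (L `<=` V)%fset -> nonneg_emeasurable f ->
  (forall s, 0 <= h s) -> (forall s s', same_off L s s' -> h s = h s') ->
  E L (fun s => f s * h s) sigma = E L f sigma * h sigma.
Proof.
move=> LV [mf f0] h0 hoff; rewrite !expectE -ge0_integralZr//;
  last exact: measurable_refresh_comp.
by apply: eq_integral => xi _; rewrite (hoff _ sigma)//;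
  exact: same_off_refresh.
Qed.

Lemma expect_cst L (c : \bar R) sigma : E L (fun=> c) sigma = c.
Proof.
rewrite expectE -[RHS]mule1 -(probability_setT (P L (full sigma))).
by rewrite -integral_cst.
Qed.

Lemma expect_V f sigma : E V f sigma = \int[mu]_xi f xi.
Proof.
have e : agree_off V (full sigma) tau by exact: splice_out.
transitivity (\int[mu]_xi f (@refresh V sigma xi)).
  rewrite expectE; apply: eq_measure_integral => A mA _.
  by rewrite /gibbs_prob /= (eq_gibbs X e).
by apply: eq_integral => xi _; rewrite /refresh restr_splice.
Qed.

Lemma integral_expect L f : (L `<=` V)%fset -> nonneg_emeasurable f ->
  \int[mu]_sigma E L f sigma = \int[mu]_sigma f sigma.
Proof. by move=> LV pf; rewrite -!(expect_V _ point) expect_tower. Qed.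

(** By the tower property the conditional probability of a null set integrates to zero, so it
    vanishes almost everywhere. This carries almost sure statements over to the conditional
    measures. *)
Lemma ae_refresh L (Q : Omega -> Prop) : (L `<=` V)%fset ->
  {ae mu, forall sigma, Q sigma} ->
  {ae mu, forall sigma, {ae P L (full sigma), forall xi, Q (refresh sigma xi)}}.
Proof.
move=> LV [N [mN N0 QN]].
have pN : nonneg_emeasurable (fun s => (\1_N s)%:E).
  split; last by move=> s; rewrite lee_fin indicE ler0n.
  by apply/measurable_EFinP; exact: measurable_indic.
have := integral_expect LV pN; rewrite integral_indic// setIT => h.
have [mEN EN0] := expect_nonneg_emeasurable L pN.
have /ae_eq_integral_abs : measurable_fun setT (E L (fun s =>
  (\1_N s)%:E)) by [].
move=> /(_ mu measurableT)[+ _].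
under eq_integral do rewrite gee0_abs//.
move=> /(_ (etrans h N0)); apply: filterS => sigma /(_ I) Es.
have mpre : measurable ((fun xi : config L S => refresh sigma xi) @^-1` N).
  by rewrite -[X in measurable X]setTI; exact: measurable_refresh.
exists ((fun xi : config L S => refresh sigma xi) @^-1` N); split => //.
  by have := Es; rewrite expectE (integral_indic (P L (full sigma))
    measurableT mpre) setIT.
by move=> xi /= nQ; exact: QN.
Qed.

End expectation.

(** * Conditional entropies *)

Section entropy.
Context {d : nat} {R : realType} {disp : measure_display}.
Context {S : measurableType disp} (X : interaction R S) (hX :
  is_spin_system d X).
Variables (V : {fset site d}) (tau : site d -> S).
Implicit Types (B C L M K : {fset site d}).
Notation Omega := (config V S).
Implicit Types (sigma : Omega) (f g : Omega -> R) (F G : Omega -> \bar R).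

Notation P L w := (gibbs_prob hX L w).
Notation mu := (gibbs_prob hX V tau).
Notation E := (cexpect X V tau).
Notation Ent := (Ent X V tau).
Notation full := (full tau).
Notation refresh := (refresh tau).
Notation same_off := (same_off tau).

(** Real-valued because [Ent] takes real functions. Where the expectation is infinite, a null set
    for integrable [f], the value is 0; hence the tower identities for [avg] hold almost everywhere
    only. *)
Definition avg L f sigma : R := fine (E L (EFin \o f) sigma).

Definition nonneg_measurable f := measurable_fun setT f /\ forall sigma,
  (0 <= f sigma)%R.

Lemma avgE L f sigma : avg L f sigma = fine (E L (EFin \o f) sigma).
Proof. by []. Qed.

Lemma nonneg_emeasurable_EFin f : nonneg_measurable f -> nonneg_emeasurable
  (EFin \o f).
Proof. by move=> [mf f0]; split=> [|s]; [exact/measurable_EFinP|rewrite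
  lee_fin]. Qed.

Lemma avg_nonneg_measurable L f : nonneg_measurable f -> nonneg_measurable (avg
  L f).
Proof.
move=> /nonneg_emeasurable_EFin/(expect_nonneg_emeasurable hX tau L)[mE E0];
  split.
  exact: (measurableT_comp (@fine_measurable R _ measurableT) mE).
by move=> s; exact: fine_ge0.
Qed.

Lemma avg_same_off L f sigma sigma' : same_off L sigma sigma' -> avg L f sigma =
  avg L f sigma'.
Proof. by move=> h; rewrite /avg (expect_same_off hX _ h). Qed.

Lemma gap_nonneg_emeasurable f g : nonneg_measurable f -> nonneg_measurable g ->
  nonneg_emeasurable (fun s => (ent_gap (f s) (g s))%:E).
Proof.
move=> [mf _] [mg _]; split; first by apply/measurable_EFinP;
  exact: measurable_ent_gap.
by move=> s; rewrite lee_fin ent_gap_ge0.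
Qed.

Lemma cst_nonneg_emeasurable (c : \bar R) :
  0 <= c -> nonneg_emeasurable (fun _ : Omega => c).
Proof. by move=> c0; split=> [|s]; [exact: measurable_cst|exact: c0]. Qed.

Lemma cst_nonneg_measurable (c : R) : (0 <= c)%R -> nonneg_measurable (fun=> c).
Proof. by move=> c0; split => //; exact: measurable_cst. Qed.

Lemma EntE L f sigma : (L `<=` V)%fset -> nonneg_measurable f ->
  Ent L f sigma = E L (fun s => (ent_gap (f s) (avg L f s))%:E) sigma.
Proof.
move=> LV [mf f0].
transitivity (E L (fun s => (f s * ln (f s / avg L f s))%:E) sigma);
  first by rewrite /avg cexpectE.
have aE (xi : config L S) : avg L f (refresh sigma xi) = avg L f sigma.
  by apply: avg_same_off; exact: same_off_refresh.
rewrite !(expectE hX).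
under eq_integral do rewrite aE.
under [RHS]eq_integral do rewrite aE.
rewrite /avg (expectE hX) /=.
exact (@integral_xlnx _ _ _ (P L (full sigma)) (fun xi :
  config L S => f (refresh sigma xi))
  (measurable_refresh_comp tau sigma mf) (fun xi => f0 _)).
Qed.

Lemma Ent_nonneg_emeasurable L f : (L `<=` V)%fset -> nonneg_measurable f ->
  nonneg_emeasurable (Ent L f).
Proof.
move=> LV nf.
rewrite (_ : Ent L f = E L (fun s => (ent_gap (f s) (avg L f s))%:E));
  last first.
  by apply/funext => s; exact: EntE.
apply: (expect_nonneg_emeasurable hX); apply: gap_nonneg_emeasurable => //.
exact: avg_nonneg_measurable.
Qed.

Lemma Ent_gap L f sigma : (L `<=` V)%fset -> nonneg_measurable f ->
  Ent L f sigma = E L (fun s => (ent_gap (f s) (avg L f sigma))%:E) sigma.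
Proof.
move=> LV nf; rewrite EntE//; apply: (eq_expect hX) => xi.
have h : same_off L (refresh sigma xi) sigma by exact: same_off_refresh.
by rewrite (avg_same_off f h).
Qed.

Lemma Ent_avg0 L f sigma : (L `<=` V)%fset -> nonneg_measurable f -> avg L f
  sigma = 0%R ->
  Ent L f sigma = 0.
Proof.
move=> LV nf a0; rewrite Ent_gap// a0.
rewrite -[RHS](expect_cst hX tau L 0 sigma); apply: (eq_expect hX) => xi.
by rewrite ent_gap0r.
Qed.

Lemma expect_gap_cst L f (c : R) sigma :
  (L `<=` V)%fset -> nonneg_measurable f ->
  (0 < c)%R -> E L (EFin \o f) sigma < +oo ->
  E L (fun s => (ent_gap (f s) c)%:E) sigma = Ent L f sigma + (ent_gap (avg L f
    sigma) c)%:E.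
Proof.
move=> LV nf c0 fin; have [mf f0] := nf; rewrite Ent_gap// !(expectE hX).
apply: (ent_gap_compensation (f := fun xi => f (refresh sigma xi))) => //.
  exact: measurable_refresh_comp.
have finE : E L (EFin \o f) sigma \is a fin_num.
  by rewrite ge0_fin_numE//; apply: (expect_ge0 hX) => s; rewrite lee_fin.
by rewrite /avg fineK// (expectE hX).
Qed.

Lemma eq_expect_ae L F G sigma : nonneg_emeasurable F -> nonneg_emeasurable G ->
  {ae P L (full sigma), forall xi, F (refresh sigma xi)
    = G (refresh sigma xi)} ->
  E L F sigma = E L G sigma.
Proof.
move=> [mF F0] [mG G0] FG; rewrite !(expectE hX);
  apply: ge0_ae_eq_integral => //.
- exact: measurable_refresh_comp.
- exact: measurable_refresh_comp.
- by apply: filterS FG => xi h _.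
Qed.

Lemma ae_eq_expect L F G : (L `<=` V)%fset ->
  nonneg_emeasurable F -> nonneg_emeasurable G ->
  {ae mu, forall sigma, F sigma = G sigma} ->
  {ae mu, forall sigma, E L F sigma = E L G sigma}.
Proof.
move=> LV nF nG /(ae_refresh LV); apply: filterS => sigma; exact: eq_expect_ae.
Qed.

Lemma ae_le_expect L F G : (L `<=` V)%fset ->
  nonneg_emeasurable F -> nonneg_emeasurable G ->
  {ae mu, forall sigma, F sigma <= G sigma} ->
  {ae mu, forall sigma, E L F sigma <= E L G sigma}.
Proof.
move=> LV [mF F0] [mG G0] /(ae_refresh LV); apply: filterS => sigma FG.
rewrite !(expectE hX); apply: ae_ge0_le_integral => //.
- exact: measurable_refresh_comp.
- exact: measurable_refresh_comp.
- by apply: filterS FG => xi h _.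
Qed.

Definition nonneg_L1 f := nonneg_measurable f /\ \int[mu]_sigma (f sigma)%:E <
  +oo.

Lemma ae_expect_fin L f : (L `<=` V)%fset -> nonneg_L1 f ->
  {ae mu, forall sigma, E L (EFin \o f) sigma < +oo}.
Proof.
move=> LV [nf fin]; have pf := nonneg_emeasurable_EFin nf.
have [mE E0] := expect_nonneg_emeasurable hX tau L pf.
have /integrable_ae : mu.-integrable setT (E L (EFin \o f)).
  apply/integrableP; split=> //.
  by under eq_integral do rewrite gee0_abs//; rewrite integral_expect.
by move=> /(_ measurableT); apply: filterS => s /(_ I) h; rewrite -ge0_fin_numE.
Qed.

Lemma ae_avgE L f : (L `<=` V)%fset -> nonneg_L1 f ->
  {ae mu, forall sigma, (avg L f sigma)%:E = E L (EFin \o f) sigma}.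
Proof.
move=> LV nf; apply: filterS (ae_expect_fin LV nf) => s h; rewrite /avg fineK//.
rewrite ge0_fin_numE//; apply: (expect_ge0 hX) => s'; rewrite lee_fin.
by have [[_]] := nf.
Qed.

Lemma avg_nonneg_L1 L f : (L `<=` V)%fset -> nonneg_L1 f -> nonneg_L1 (avg L f).
Proof.
move=> LV nf; have [nnf fin] := nf; split; first exact: avg_nonneg_measurable.
have pf := nonneg_emeasurable_EFin nnf.
have [mE E0] := expect_nonneg_emeasurable hX tau L pf.
have [ma a0] := nonneg_emeasurable_EFin (avg_nonneg_measurable L nnf).
have -> : \int[mu]_sigma (avg L f sigma)%:E = \int[mu]_sigma E L (EFin \o f)
  sigma.
  apply: ge0_ae_eq_integral => //.
    by move=> s _; exact: a0.
  by apply: filterS (ae_avgE LV nf) => s h _.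
by rewrite integral_expect.
Qed.

Lemma ae_expect_avg L M f : (L `<=` M)%fset -> (M `<=` V)%fset -> nonneg_L1 f ->
  {ae mu, forall sigma, E M (EFin \o avg L f) sigma = E M (EFin \o f) sigma}.
Proof.
move=> LM MV nf; have LV := fsubset_trans LM MV; have [nnf _] := nf.
have pf := nonneg_emeasurable_EFin nnf.
have := ae_eq_expect MV (nonneg_emeasurable_EFin (avg_nonneg_measurable L nnf))
  (expect_nonneg_emeasurable hX tau L pf) (ae_avgE LV nf).
by apply: filterS => s ->; rewrite expect_tower.
Qed.

Lemma ae_avg_avg L M f : (L `<=` M)%fset -> (M `<=` V)%fset -> nonneg_L1 f ->
  {ae mu, forall sigma, avg M (avg L f) sigma = avg M f sigma}.
Proof.
move=> LM MV nf; apply: filterS (ae_expect_avg LM MV nf) => sigma.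
by rewrite avgE => ->.
Qed.

Lemma ae_eq_avg L f g : (L `<=` V)%fset -> nonneg_measurable f ->
  nonneg_measurable g ->
  {ae mu, forall sigma, f sigma = g sigma} ->
  {ae mu, forall sigma, avg L f sigma = avg L g sigma}.
Proof.
move=> LV nf ng fg; have pf := nonneg_emeasurable_EFin nf;
  have pg := nonneg_emeasurable_EFin ng.
have : {ae mu, forall sigma, (EFin \o f) sigma = (EFin \o g) sigma}.
  by apply: filterS fg => s /= ->.
by move=> /(ae_eq_expect LV pf pg); apply: filterS => s; rewrite /avg => ->.
Qed.

Lemma ae_eq_Ent L f g : (L `<=` V)%fset -> nonneg_measurable f ->
  nonneg_measurable g ->
  {ae mu, forall sigma, f sigma = g sigma} ->
  {ae mu, forall sigma, Ent L f sigma = Ent L g sigma}.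
Proof.
move=> LV nf ng fg; have afg := ae_eq_avg LV nf ng fg.
have h : {ae mu, forall sigma, (ent_gap (f sigma) (avg L f sigma))%:E =
                               (ent_gap (g sigma) (avg L g sigma))%:E}.
  by apply: filterS2 fg afg => s -> ->.
have := ae_eq_expect LV (gap_nonneg_emeasurable nf (avg_nonneg_measurable L nf))
  (gap_nonneg_emeasurable ng (avg_nonneg_measurable L ng)) h.
by apply: filterS => s; rewrite !EntE.
Qed.

(** With [c] the mean of [f] under [mu_M], the compensation identity for [mu_L] splits the expected
    gap to [c] into [Ent L f] and the gap from [avg L f] to [c]; averaging over [M] gives the two
    terms. *)
Lemma Ent_chain_rule L M f : (L `<=` M)%fset -> (M `<=` V)%fset -> nonneg_L1 f
  ->
  {ae mu, forall sigma, Ent M f sigma = E M (Ent L f) sigma + Ent M (avg L f)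
    sigma}.
Proof.
move=> LM MV nf; have LV := fsubset_trans LM MV; have [nnf _] := nf.
have na := avg_nonneg_measurable L nnf; have pEnt := Ent_nonneg_emeasurable LV
  nnf.
have finL := ae_refresh MV (ae_expect_fin LV nf).
apply: filterS3 (ae_expect_fin MV nf) (ae_expect_avg LM MV nf) finL =>
  sigma finM aMeq finLs.
have aM : avg M (avg L f) sigma = avg M f sigma by rewrite /avg aMeq.
pose c := avg M f sigma.
have : (0 <= c)%R by have [_] := avg_nonneg_measurable M nnf; exact.
(* Compensation needs a positive reference. If [c = 0], then [avg L f] vanishes almost surely under
   [mu_M], and all three entropies are zero. *)
rewrite le_eqVlt => /predU1P[c0|c0].
  rewrite !(Ent_avg0 MV)// ?aM// adde0; apply/esym.
  have : E M (EFin \o avg L f) sigma = 0.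
    rewrite aMeq -[LHS]fineK; first by rewrite -/(avg M f sigma) -/c -c0.
    by rewrite ge0_fin_numE//; apply: (expect_ge0 hX) => s; rewrite lee_fin;
      have [_] := nnf.
  rewrite (expectE hX).
  have [ma a0] := na.
  move=> /(ge0_eint_eq0 (measurable_refresh_comp tau sigma ma) (fun=> a0 _)) h.
  rewrite -[RHS](expect_cst hX tau M 0 sigma);
  apply: (eq_expect_ae pEnt (cst_nonneg_emeasurable (lexx 0))).
  by apply: filterS h => xi h; exact: Ent_avg0.
rewrite (Ent_gap _ MV nnf) (Ent_gap _ MV na) aM -/c.
have pc := cst_nonneg_measurable (ltW c0).
have pg := gap_nonneg_emeasurable nnf pc;
  have pag := gap_nonneg_emeasurable na pc.
rewrite -(expectD hX tau M sigma pEnt pag) -(expect_tower hX _ _ LM MV pg).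
apply: eq_expect_ae.
- exact: expect_nonneg_emeasurable.
- by split=> [|s]; [apply: emeasurable_funD; [case: pEnt|case: pag]|
    apply: adde_ge0; [case: pEnt|case: pag]].
- by apply: filterS finLs => xi h; exact: expect_gap_cst.
Qed.

(** For almost every fixed boundary condition of [M] this is [ent_gap_le_of_commuting] under [mu_M],
    with [a = g], [b = avg C g], [k = avg K g] and the constant [c = avg M g sigma]. *)
Lemma Ent_avg_le_of_commuting K C M g : (K `<=` M)%fset -> (C `<=` M)%fset ->
  (M `<=` V)%fset -> nonneg_L1 g ->
  {ae mu, forall sigma, E K (E C (EFin \o g)) sigma = E M (E C (EFin \o g))
    sigma} ->
  {ae mu, forall sigma, Ent M (avg K g) sigma <= E M (Ent C g) sigma}.
Proof.
move=> KM CM MV ng comm; have [nng _] := ng.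
have KV := fsubset_trans KM MV; have CV := fsubset_trans CM MV.
have pg := nonneg_emeasurable_EFin nng; have [mg g0] := nng.
have nK := avg_nonneg_measurable K nng; have [mK K0] := nK.
have nC := avg_nonneg_measurable C nng; have [mC C0] := nC.
have pEC := expect_nonneg_emeasurable hX tau C pg.
have pEK := expect_nonneg_emeasurable hX tau K pg.
apply: filterS2 (filterI (ae_expect_fin MV ng) (ae_expect_avg KM MV ng))
  (filterI (ae_refresh MV comm) (filterI (ae_refresh MV (ae_avgE KV ng))
    (ae_refresh MV (ae_avgE CV ng))))
  => sigma [finM aMeq] [commM [aK aC]].
pose c := avg M g sigma.
have cE : c%:E = E M (EFin \o g) sigma.
  by rewrite /c /avg fineK// ge0_fin_numE//; apply: (expect_ge0 hX); case: pg.
have aM : avg M (avg K g) sigma = c by rewrite /avg aMeq.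
have : (0 <= c)%R by have [_] := avg_nonneg_measurable M nng; exact.
rewrite le_eqVlt => /predU1P[c0|c0].
  rewrite (Ent_avg0 MV nK) ?aM//; apply: (expect_ge0 hX) => s.
  by have [_] := Ent_nonneg_emeasurable CV nng.
rewrite (Ent_gap _ MV nK) aM.
have -> : E M (Ent C g) sigma = E M (fun s =>
  (ent_gap (g s) (avg C g s))%:E) sigma.
  rewrite -[RHS](expect_tower hX _ _ CM MV (gap_nonneg_emeasurable nng nC)).
  by apply: (eq_expect hX) => xi; exact: EntE.
have mulP F (h : Omega -> R) : nonneg_emeasurable F -> nonneg_measurable h ->
    nonneg_emeasurable (fun s => F s * (h s)%:E).
  move=> [mF F0] [mh h0]; split; last by move=> s; rewrite mule_ge0// lee_fin.
  by apply: emeasurable_funM => //; exact/measurable_EFinP.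
(* The defining property of conditional expectation: tested against functions of the spins outside
   [B], [F] and [E B F] are indistinguishable. *)
have pull B (h : Omega -> R) F : (B `<=` M)%fset -> nonneg_emeasurable F ->
  nonneg_measurable h ->
    (forall s s', same_off B s s' -> h s = h s') ->
    E M (fun s => F s * (h s)%:E) sigma = E M (fun s =>
      E B F s * (h s)%:E) sigma.
  move=> BM nF nh hB; have BV := fsubset_trans BM MV.
  rewrite -[LHS](expect_tower hX _ _ BM MV (mulP _ _ nF nh)).
  apply: (eq_expect hX) => xi; rewrite (expect_pull hX _ BV nF)//.
    by move=> s; rewrite lee_fin; have [_] := nh.
  by move=> s s' ss'; rewrite (hB _ _ ss').
have compK (G : R -> R) : measurable_fun setT G -> (forall y, (0 <= G y)%R) ->
    nonneg_measurable (G \o avg K g).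
  by move=> mG G0; split=> [|s]; [exact: (measurableT_comp mG mK)|exact: G0].
have offK (G : R -> R) s s' : same_off K s s' -> (G \o avg K g)
  s = (G \o avg K g) s'.
  by move=> h; rewrite /= (avg_same_off _ h).
rewrite !(expectE hX).
apply: (ent_gap_le_of_commuting (a := fun xi => g (refresh sigma xi))
  (b := fun xi => avg C g (refresh sigma xi))
  (k := fun xi => avg K g (refresh sigma xi))) => //;
    try exact: measurable_refresh_comp.
- by rewrite cE -aMeq (expectE hX).
(* Testing [g] against the indicator of the event that [avg C g] vanishes shows that [g] vanishes
   there almost surely. *)
- pose z : R -> R := \1_[set (0 : R)%R].
  have mz : measurable_fun setT z by exact: measurable_indic.
  have z0 y : (0 <= z y)%R by rewrite /z indicE ler0n.
  have nz : nonneg_measurable (z \o avg C g) by split=> [|s];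
    [exact: (measurableT_comp mz mC)|exact: z0].
  have zoff s s' : same_off C s s' -> (z \o avg C g) s = (z \o avg C g) s'.
    by move=> h; rewrite /= (avg_same_off _ h).
  have h0 : \int[P M (full sigma)]_xi (g (refresh sigma xi)
    * z (avg C g (refresh sigma xi)))%:E = 0.
    transitivity (E M (fun s => (EFin \o g) s * ((z \o avg C g) s)%:E) sigma).
      by rewrite (expectE hX).
    rewrite (pull C)// -[RHS](expect_cst hX tau M 0 sigma); apply: eq_expect_ae.
    + exact: (mulP _ _ pEC nz).
    + exact: cst_nonneg_emeasurable.
    + apply: filterS aC => xi <-; rewrite -EFinM /= /z indicE.
      by case: (boolP (_ \in _)); rewrite ?mulr0// inE => ->; rewrite mul0r.
  have /ge0_eint_eq0 : measurable_fun setT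
      (fun xi : config M S => g (refresh sigma xi)
        * z (avg C g (refresh sigma xi)))%R.
    apply: measurable_funM; first exact: measurable_refresh_comp.
    exact: (measurableT_comp mz (measurable_refresh_comp tau sigma mC)).
  move=> /(_ (P M (full sigma)) (fun xi => mulr_ge0 (g0 _) (z0 _)) h0).
  by apply: filterS => xi + b0; rewrite b0 /z indicE mem_set// mulr1.
- move=> G mG G0.
  transitivity (E M (fun s => (EFin \o g) s * ((G \o avg K g) s)%:E) sigma);
    first by rewrite (expectE hX).
  rewrite (pull K _ _ KM pg (compK _ mG G0) (offK G)).
  transitivity (E M (fun s => (EFin \o avg K g) s * ((G \o avg K g) s)%:E)
    sigma); last by rewrite (expectE hX).
  apply: eq_expect_ae.
  + exact: (mulP _ _ pEK (compK _ mG G0)).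
  + by apply: mulP; [exact: nonneg_emeasurable_EFin|exact: compK].
  + by apply: filterS aK => xi <-.
(* The one place where commutation enters: conditioning [E C g] on the spins outside [K] gives
   [E M (E C g)], which is the constant [c]. *)
- move=> G mG G0.
  transitivity (E M (fun s => (EFin \o avg C g) s * ((G \o avg K g) s)%:E)
    sigma); first by rewrite (expectE hX).
  transitivity (E M (fun s => E C (EFin \o g) s * ((G \o avg K g) s)%:E) sigma).
    apply: eq_expect_ae.
    + by apply: mulP; [exact: nonneg_emeasurable_EFin|exact: compK].
    + by apply: mulP => //; exact: compK.
    + by apply: filterS aC => xi <-.
  rewrite (pull K _ _ KM pEC (compK _ mG G0) (offK G)).
  transitivity (E M (fun s => c%:E * ((G \o avg K g) s)%:E) sigma).
    apply: eq_expect_ae.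
    + apply: mulP; [exact: (expect_nonneg_emeasurable hX)|exact: compK].
    + apply: (mulP (fun=> c%:E)); last exact: compK.
      by apply: cst_nonneg_emeasurable; rewrite lee_fin ltW.
    + apply: filterS commM => xi ->.
      by rewrite (expect_tower hX) // (expect_refresh hX) // cE.
  have [pG0 pG1] := nonneg_emeasurable_EFin (compK _ mG G0).
  by rewrite (expectZl hX) ?ltW// (expectE hX).
Qed.

Lemma ent_gap1_le (a : R) : (0 <= a -> ent_gap a 1 <= a * Num.max 0 (ln a)
  + 1)%R.
Proof.
move=> a0; rewrite ent_gapE// ln1 subr0.
have : (a * ln a <= a * Num.max 0 (ln a))%R by rewrite ler_wpM2l// le_max lexx
  orbT.
by lra.
Qed.

(** Young's inequality at [b = t = 1] gives [a <= ent_gap a 1 + (expR 1 - 1)]. Inserting this into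
    [a * ln a = ent_gap a 1 + a - 1] produces the factor 2. *)
Lemma xlnx_le_ent_gap1 (a : R) : (0 <= a ->
  a * Num.max 0 (ln a) <= 2 * ent_gap a 1 + (expR 1 - 1))%R.
Proof.
move=> a0; have := young 1 a0 ltr01; rewrite mul1r mulr1 => h.
have g0 := ent_gap_ge0 a 1; have := ent_gapE a0 ltr01; rewrite ln1 subr0 => gE.
by rewrite maxEle; case: ifP => _; [lra|rewrite mulr0; lra].
Qed.

(** Membership becomes finiteness of a divergence from 1, a form in which stability under
    conditional expectation is immediate from compensation. *)
Lemma nonneg_LlogLP f : nonneg_LlogL X V tau f <->
  nonneg_measurable f /\ \int[mu]_sigma (ent_gap (f sigma) 1)%:E < +oo.
Proof.
have mln (h : Omega -> R) : measurable_fun setT h ->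
    measurable_fun setT (fun s => h s * Num.max 0 (ln (h s)))%R.
  move=> mh; apply: measurable_funM => //; apply: measurable_maxr.
    exact: measurable_cst.
  by apply: measurableT_comp => //; exact: measurable_ln.
have ln0 (h : Omega -> R) : (forall s, 0 <= h s)%R ->
    forall s, (0 <= h s * Num.max 0 (ln (h s)))%R.
  by move=> h0 s; rewrite mulr_ge0// le_max lexx.
have mg (h : Omega -> R) : measurable_fun setT h ->
    measurable_fun setT (fun s => ent_gap (h s) 1%R).
  by move=> mh; apply: measurable_ent_gap => //; exact: measurable_cst.
have mc (c : R) : measurable_fun setT (fun _ :
  Omega => c) by exact: measurable_cst.
split.
  move=> [mf f0 /integrableP[mi]].
  under eq_integral do rewrite gee0_abs ?lee_fin ?ln0//.
  move=> fin; split => //.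
  apply: (@le_lt_trans _ _ (\int[mu]_sigma (f sigma * Num.max 0 (ln (f sigma))
    + 1)%:E)).
    apply: ge0_le_integral => //.
    - by move=> s _; rewrite lee_fin ent_gap_ge0.
    - by apply/measurable_EFinP; exact: mg.
    - by apply/measurable_EFinP/measurable_funD; [exact: mln|exact: mc].
    - by move=> s _; rewrite lee_fin ent_gap1_le.
  rewrite ge0_eintD//; [|exact: mln|exact: ln0].
  by rewrite eint_cst lte_add_pinfty// ltry.
move=> [[mf f0] fin]; split => //; apply/integrableP; split.
  by apply/measurable_EFinP; exact: mln.
under eq_integral do rewrite gee0_abs ?lee_fin ?ln0//.
have e0 : (0 <= expR 1 - 1 :> R)%R by rewrite subr_ge0 -[leLHS]expR0 ler_expR.
apply: (@le_lt_trans _ _ (\int[mu]_sigma (ent_gap (f sigma)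
  1 * 2 + (expR 1 - 1))%:E)).
  apply: ge0_le_integral => //.
  - by move=> s _; rewrite lee_fin ln0.
  - by apply/measurable_EFinP; exact: mln.
  - apply/measurable_EFinP/measurable_funD; last exact: mc.
    by apply: measurable_funM; [exact: mg|exact: mc].
  - by move=> s _; rewrite lee_fin [(ent_gap _ _ * 2)%R]mulrC xlnx_le_ent_gap1.
rewrite ge0_eintD//; last 2 first.
- by apply: measurable_funM; [exact: mg|exact: mc].
- by move=> s; rewrite mulr_ge0// ent_gap_ge0.
rewrite ge0_eintZr//; [|exact: mg|by move=> s; exact: ent_gap_ge0].
rewrite eint_cst lte_add_pinfty ?ltry//.
rewrite ltey_eq fin_numM// ge0_fin_numE//.
by apply: integral_ge0 => s _; rewrite lee_fin ent_gap_ge0.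
Qed.

Lemma nonneg_LlogL_L1 f : nonneg_LlogL X V tau f -> nonneg_L1 f.
Proof.
move=> /nonneg_LlogLP[[mf f0] fin]; split => //.
have e0 : (0 <= expR 1 - 1 :> R)%R by rewrite subr_ge0 -[leLHS]expR0 ler_expR.
have mg : measurable_fun setT (fun s => ent_gap (f s) 1%R).
  by apply: measurable_ent_gap => //; exact: measurable_cst.
apply: (@le_lt_trans _ _ (\int[mu]_sigma (ent_gap (f sigma)
  1 + (expR 1 - 1))%:E)).
  apply: ge0_le_integral => //.
  - by move=> s _; rewrite lee_fin.
  - exact/measurable_EFinP.
  - by apply/measurable_EFinP/measurable_funD => //; exact: measurable_cst.
  - by move=> s _; rewrite lee_fin; have := young 1 (f0 s) ltr01;
      rewrite mul1r mulr1.
rewrite ge0_eintD//; last by move=> s; exact: ent_gap_ge0.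
by rewrite eint_cst lte_add_pinfty ?ltry.
Qed.

(** Jensen's inequality: by compensation at [c = 1], the conditional mean of [ent_gap f 1] exceeds
    [ent_gap (avg L f) 1] by [Ent L f >= 0]. *)
Lemma avg_nonneg_LlogL L f : (L `<=` V)%fset ->
  nonneg_LlogL X V tau f -> nonneg_LlogL X V tau (avg L f).
Proof.
move=> LV lf; have nf := nonneg_LlogL_L1 lf; have [nnf _] := nf.
have /nonneg_LlogLP[_ fin] := lf.
have na := avg_nonneg_measurable L nnf; apply/nonneg_LlogLP; split => //.
have p1 := cst_nonneg_measurable (ler01 : (0 <= 1 :> R)%R).
have pg := gap_nonneg_emeasurable nnf p1;
  have [mag ag0] := gap_nonneg_emeasurable na p1.
have [mEg Eg0] := expect_nonneg_emeasurable hX tau L pg.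
apply: le_lt_trans fin; rewrite -[leRHS](integral_expect hX tau LV pg).
apply: ae_ge0_le_integral => //.
apply: filterS (ae_expect_fin LV nf) => s h _.
rewrite expect_gap_cst// leeDr//.
by have [_] := Ent_nonneg_emeasurable LV nnf.
Qed.

End entropy.

(** * Product structure and induction on the rows *)

Section product_structure.
Context {d : nat} {R : realType} {disp : measure_display}.
Context {S : measurableType disp} (X : interaction R S) (hX :
  is_spin_system d X).
Variables (V : {fset site d}) (tau : site d -> S).
Notation Omega := (config V S).
Implicit Types (sigma : Omega) (h : Omega -> \bar R).

Notation P L w := (gibbs_prob hX L w).
Notation mu := (gibbs_prob hX V tau).
Notation E := (cexpect X V tau).
Notation full := (full tau).
Notation refresh := (refresh tau).
Notation same_off := (same_off tau).

Variables (L : {fset site d}) (LV : (L `<=` V)%fset).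
Variables (n : nat) (Rw : 'I_n -> {fset site d}).
Hypothesis RwL : forall i, (Rw i `<=` L)%fset.
Hypothesis prodL : product_along X V tau L Rw.

(** Taking the full space in every other row turns the remaining factors into 1. The null set does
    not depend on [B]. *)
Lemma product_along_marginal i :
  {ae mu, forall sigma, forall B : set (config (Rw i) S), measurable B ->
    gibbs X L (full sigma) [set xi | B (restr (Rw i)
      (splice xi (full sigma)))] =
    gibbs X (Rw i) (full sigma) B}.
Proof.
have p : {ae mu, forall sigma, _} := prodL.
apply: filterS p => sigma h B mB.
pose Bs := @dfwith _ (fun k : 'I_n => set (config (Rw k) S)) (fun k =>
  setT) i B.
have mBs k : measurable (Bs k).
  by rewrite /Bs; case: dfwithP => [|j ij]; [exact: mB|exact: measurableT].
have := h Bs mBs; rewrite (bigD1 i)//= big1 ?mule1; last first.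
  by move=> k ki; rewrite /Bs dfwithout 1?eq_sym// (gibbsT hX).
rewrite {2}/Bs dfwithin => <-; congr (gibbs X L _ _).
apply/seteqP; split=> xi /=.
  by move=> Bxi k; rewrite /Bs; case: dfwithP.
by move=> /(_ i); rewrite /Bs dfwithin.
Qed.

(** Such an [h] sees only the spins in row [i] and outside [L], so only the marginal of [mu_L] on
    that row matters. The quantifier over [h] stands inside the almost sure statement because [h]
    will be chosen depending on [sigma]. *)
Lemma expect_row i : {ae mu, forall sigma, forall h, nonneg_emeasurable h ->
  (forall s s', same_off (L `\` Rw i)%fset s s' -> h s = h s') ->
  E L h sigma = E (Rw i) h sigma}.
Proof.
apply: filterS (product_along_marginal i) => sigma hm h [mh h0] hoff.
have RV := fsubset_trans (RwL i) LV.
pose phi (xi : config L S) : config (Rw i) S := restr (Rw i)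
  (splice xi (full sigma)).
have mphi : measurable_fun setT phi.
  exact: (measurableT_comp (f := fun w : config (site d) S => restr (Rw i) w :
    config (Rw i) S)
    (g := fun xi : config L S => splice xi (full sigma) : config (site d) S)
    (@measurable_restr _ _ _ (Rw i)) (measurable_splicel (full sigma))).
rewrite !(expectE hX).
transitivity (\int[P L (full sigma)]_xi h (refresh sigma (phi xi))).
  apply: eq_integral => xi _; apply: hoff => x.
  rewrite !full_refresh// inE negb_and negbK => xLR.
  rewrite /phi; case: (boolP (x \in Rw i)) => xR.
    by rewrite splice_restr xR.
  rewrite [RHS]splice_out// splice_out//.
  by move: xLR; rewrite (negbTE xR).
have [m mE] := pushforward_measureP (P L (full sigma)) mphi.
transitivity (\int[m]_eta h (@refresh (Rw i) sigma eta)).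
  have mr : measurable_fun setT (fun eta :
    config (Rw i) S => h (refresh sigma eta)).
    exact: (measurable_refresh_comp tau sigma mh).
  by rewrite mE ge0_integral_pushforward.
by apply: eq_measure_integral => A mA _; rewrite mE /pushforward; exact: hm.
Qed.

Lemma expect_row_extend i (Q : {fset site d}) : (Q `<=` L)%fset ->
  {ae mu, forall sigma, forall h, nonneg_emeasurable h ->
    (forall s s', same_off Q s s' -> h s = h s') ->
    E (Rw i) h sigma = E (Rw i `|` Q)%fset h sigma}.
Proof.
move=> QL; set K := Rw i; set M := (K `|` Q)%fset.
have KL : (K `<=` L)%fset := RwL i.
have KM : (K `<=` M)%fset := fsubsetUl _ _.
have ML : (M `<=` L)%fset by rewrite fsubUset KL.
have MV := fsubset_trans ML LV; have KV := fsubset_trans KL LV.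
apply: filterS2 (expect_row i) (ae_refresh MV (expect_row i)) =>
  sigma hs hxi h [mh h0] hoff.
(* freezing the spins outside [M] makes [h] independent of [L \ K] *)
pose frz (s : Omega) : Omega := refresh sigma (restr M (full s)).
have mfrz : measurable_fun setT frz.
  have mr : measurable_fun setT (fun s : Omega => restr M (full s) :
    config M S).
    exact: (measurableT_comp (f := fun w : config (site d) S => restr M w :
      config M S)
      (@measurable_restr _ _ _ M) (@measurable_full _ _ _ V tau)).
  exact: (measurableT_comp (f := fun xi : config M S => refresh sigma xi)
    (@measurable_refresh _ _ _ V tau M sigma) mr).
have frzE s : same_off M s sigma -> frz s = s.
  exact: refresh_restr.
pose hf := h \o frz.
have nhf : nonneg_emeasurable hf.
  by split; [exact: (measurableT_comp mh mfrz)|move=> s; exact: h0].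
have hfoff s s' : same_off (L `\` K)%fset s s' -> hf s = hf s'.
  move=> ss'; apply: hoff => x xQ; rewrite !full_refresh// !splice_restr.
  case: ifPn => // xM; apply: ss'.
  by move: xM; rewrite !inE (negbTE xQ) orbF => ->.
have hfE B : (B `<=` M)%fset -> E B h sigma = E B hf sigma.
  move=> BM; apply: (eq_expect hX) => xi; rewrite /hf /= frzE//.
  by apply: (same_off_sub BM); apply: same_off_refresh;
    exact: (fsubset_trans BM MV).
rewrite (hfE K)// (hfE M)// -(hs _ nhf hfoff).
rewrite -(expect_tower hX _ _ KM MV nhf).
rewrite -[LHS](expect_cst hX tau M _ sigma).
apply: eq_expect_ae.
- by apply: cst_nonneg_emeasurable; apply: (expect_ge0 hX); case: nhf.
- exact: expect_nonneg_emeasurable.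
- by apply: filterS hxi => xi hx; rewrite -(hx _ nhf hfoff) (expect_refresh hX).
Qed.

End product_structure.

(** * Adding one row at a time *)

Section row_induction.
Context {d : nat} {R : realType} {disp : measure_display}.
Context {S : measurableType disp} (X : interaction R S) (hX :
  is_spin_system d X).
Variables (V : {fset site d}) (tau : site d -> S).
Notation Omega := (config V S).
Implicit Types (sigma : Omega) (h : Omega -> \bar R).

Notation P L w := (gibbs_prob hX L w).
Notation mu := (gibbs_prob hX V tau).
Notation E := (cexpect X V tau).
Notation Ent := (Ent X V tau).
Notation avg := (avg X tau).

(** The convention for the empty set comes out of the general definition; it serves the base case of
    the induction. *)
Lemma expect0 F sigma : E fset0 F sigma = F sigma.
Proof.
rewrite -[RHS](expect_cst hX tau fset0 _ sigma); apply: (eq_expect hX) => xi.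
congr F; rewrite /refresh -[RHS](restr_splice sigma tau); congr restr.
by apply/funext => x; rewrite splice_out.
Qed.

Lemma Ent0 f sigma : nonneg_measurable f -> Ent fset0 f sigma = 0.
Proof.
move=> nf; rewrite (EntE hX)// expect0 avgE expect0 /= ent_gapxx//.
by have [_] := nf.
Qed.

Variables (L : {fset site d}) (LV : (L `<=` V)%fset).
Variables (n m : nat) (A : 'I_n -> 'I_m -> {fset site d}).
Hypothesis rowsL : forall i, (rows A i `<=` L)%fset.
Hypothesis disj : forall i k, i != k -> [disjoint rows A i & rows A k]%fset.
Hypothesis prodL : product_along X V tau L (rows A).
Variables (s : 'I_n -> R) (t : R) (s_le : forall i, (s i <= t)%R) (s_ge0 :
  forall i, (0 <= s i)%R).
Hypothesis hrow : forall (i : 'I_n) (f : Omega -> R), nonneg_LlogL X V tau f ->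
  {ae mu, forall sigma, Ent (rows A i) f sigma <=
    (s i)%:E * \sum_(j < m) E (rows A i) (Ent (A i j) f) sigma}.

Lemma sub_rows i j : (A i j `<=` rows A i)%fset.
Proof. by apply: bigfcup_sup; rewrite ?mem_enum. Qed.

Lemma rows_union_step (i : 'I_n) (Rr : {fset site d}) (Q :
  'I_m -> {fset site d}) :
  (Rr `<=` L)%fset -> [disjoint rows A i & Rr]%fset -> (forall j,
    Q j `<=` Rr)%fset ->
  (0 <= t)%R ->
  (forall f : Omega -> R, nonneg_LlogL X V tau f ->
    {ae mu, forall sigma, Ent Rr f sigma <=
      t%:E * \sum_(j < m) E Rr (Ent (Q j) f) sigma}) ->
  forall f : Omega -> R, nonneg_LlogL X V tau f ->
    {ae mu, forall sigma, Ent (rows A i `|` Rr)%fset f sigma <=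
      t%:E * \sum_(j < m) E (rows A i `|` Rr)%fset (Ent (A i j `|` Q j)%fset f)
        sigma}.
Proof.
move=> RL dis QR t0 IH f lf; set K := rows A i; set Lm := (K `|` Rr)%fset.
have KL : (K `<=` L)%fset := rowsL i.
have LmV : (Lm `<=` V)%fset by apply: fsubset_trans LV; rewrite fsubUset KL.
have KLm : (K `<=` Lm)%fset := fsubsetUl _ _.
have RLm : (Rr `<=` Lm)%fset := fsubsetUr _ _.
have KV := fsubset_trans KLm LmV; have RV := fsubset_trans RLm LmV.
have PK j : (A i j `<=` K)%fset := sub_rows i j.
have PV j := fsubset_trans (PK j) KV.
have QV j := fsubset_trans (QR j) RV.
have CLm j : (A i j `|` Q j `<=` Lm)%fset by exact: fsetUSS.
have MLm j : (K `|` Q j `<=` Lm)%fset by exact: fsetUSS.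
have CM j : (A i j `|` Q j `<=` K `|` Q j)%fset by exact: fsetUSS.
have CV j := fsubset_trans (CLm j) LmV.
have MV j := fsubset_trans (MLm j) LmV.
have nf := nonneg_LlogL_L1 hX lf; have [nnf _] := nf.
have lg := avg_nonneg_LlogL hX KV lf.
have ng := avg_nonneg_L1 KV nf; have [nng _] := ng.
have nEnt B (g : Omega -> R) : (B `<=` V)%fset -> nonneg_measurable g ->
  nonneg_emeasurable (Ent B g).
  exact: Ent_nonneg_emeasurable.
have nE B (F : Omega -> \bar R) : nonneg_emeasurable F -> nonneg_emeasurable (E
  B F).
  exact: (expect_nonneg_emeasurable hX).
have nsum B (F : 'I_m -> Omega -> \bar R) :
  (forall j, nonneg_emeasurable (F j)) ->
    nonneg_emeasurable (fun s => \sum_(j < m) E B (F j) s).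
  move=> nF; split=> [|w]; last by apply: sume_ge0 => j _;
    case: (nE B _ (nF j)).
  by apply: emeasurable_sum => j; case: (nE B _ (nF j)).
have nZ (c : R) (F : Omega -> \bar R) : (0 <= c)%R -> nonneg_emeasurable F ->
  nonneg_emeasurable (fun s => c%:E * F s).
  move=> c0 [mF F0]; split=> [|w]; last by rewrite mule_ge0.
  by apply: emeasurable_funM => //; exact: measurable_cst.
have towersum B (c : R) (F : 'I_m -> Omega -> \bar R) sigma :
  (B `<=` Lm)%fset -> (0 <= c)%R ->
    (forall j, nonneg_emeasurable (F j)) ->
    E Lm (fun s => c%:E * \sum_(j < m) E B (F j) s) sigma =
    c%:E * \sum_(j < m) E Lm (F j) sigma.
  move=> BLm c0 nF; rewrite (expectZl hX)//; last exact: nsum.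
  rewrite (expect_sum hX); last by move=> j; exact: nE.
  by congr (_ * _); apply: eq_bigr => j _; rewrite (expect_tower hX).
have step1 := Ent_chain_rule KLm LmV nf.
have step2 : {ae mu, forall sigma, E Lm (Ent K f) sigma <=
    (s i)%:E * \sum_(j < m) E Lm (Ent (A i j) f) sigma}.
  have nEA j : nonneg_emeasurable (Ent (A i j) f) by exact: nEnt.
  have := ae_le_expect LmV (nEnt _ _ KV nnf) (nZ _ _ (s_ge0 i) (nsum K _ nEA))
    (hrow i lf).
  by apply: filterS => sigma; rewrite towersum.
(* The tool bounds the entropy of [avg K g]. For [g = avg K f] and for [g = avg (A i j) f] this is
   [avg K f] again, almost everywhere. *)
have avgK B M : (B `<=` K)%fset -> (M `<=` V)%fset ->
    {ae mu, forall sigma, Ent M (avg K (avg B f)) sigma = Ent M (avg K f)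
      sigma}.
  move=> BK MV'; apply: ae_eq_Ent => //; last exact: ae_avg_avg.
  by do 2 apply: (avg_nonneg_measurable hX).
(* [E C g] ignores the spins in [C], in particular those in [Q'], so [expect_row_extend] applies to
   it. *)
have comm C Q' (g : Omega -> R) : (Q' `<=` C)%fset -> (Q' `<=` L)%fset ->
  nonneg_measurable g ->
    {ae mu, forall sigma, E K (E C (EFin \o g))
      sigma = E (K `|` Q')%fset (E C (EFin \o g)) sigma}.
  move=> QC QL ngg; apply: filterS (expect_row_extend hX LV rowsL prodL i QL)
    => sigma; apply.
    exact: nE (nonneg_emeasurable_EFin ngg).
  by move=> w w' ww'; apply: (expect_same_off hX); exact: same_off_sub QC ww'.
have step3 : {ae mu, forall sigma, Ent Lm (avg K f)
  sigma <= E Lm (Ent Rr (avg K f)) sigma}.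
  have := Ent_avg_le_of_commuting KLm RLm LmV ng (comm _ _ _ (fsubset_refl _)
    RL nng).
  by apply: filterS2 (avgK K Lm (fsubset_refl _) LmV) => sigma ->.
have step4 : {ae mu, forall sigma, E Lm (Ent Rr (avg K f)) sigma <=
    t%:E * \sum_(j < m) E Lm (Ent (Q j) (avg K f)) sigma}.
  have nEQ j : nonneg_emeasurable (Ent (Q j) (avg K f)) by exact: nEnt.
  have := ae_le_expect LmV (nEnt _ _ RV nng) (nZ _ _ t0 (nsum Rr _ nEQ))
    (IH _ lg).
  by apply: filterS => sigma; rewrite towersum.
have step5 j : {ae mu, forall sigma, E Lm (Ent (Q j) (avg K f)) sigma <=
    E Lm (Ent (A i j `|` Q j)%fset (avg (A i j) f)) sigma}.
  have QM : (Q j `<=` K `|` Q j)%fset := fsubsetUr _ _.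
  have KM : (K `<=` K `|` Q j)%fset := fsubsetUl _ _.
  have nPf := avg_nonneg_L1 (PV j) nf; have [nnPf _] := nPf.
  have a1 := Ent_chain_rule QM (MV j) ng.
  have a2 := Ent_avg_le_of_commuting KM (CM j) (MV j) nPf
    (comm _ _ _ (fsubsetUr _ _) (fsubset_trans (QR j) RL) nnPf).
  have a : {ae mu, forall sigma, E (K `|` Q j)%fset (Ent (Q j) (avg K f))
    sigma <=
      E (K `|` Q j)%fset (Ent (A i j `|` Q j)%fset (avg (A i j) f)) sigma}.
    apply: filterS3 a1 a2 (avgK _ _ (PK j) (MV j)) => sigma e1 h2 e3.
    apply: (le_trans _ h2); rewrite e3 e1; apply: leeDl.
    by have [_] := nEnt _ _ (MV j) (avg_nonneg_measurable hX tau (Q j) nng).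
  have := ae_le_expect LmV (nE _ _ (nEnt _ _ (QV j) nng))
    (nE _ _ (nEnt _ _ (CV j) nnPf)) a.
  by apply: filterS => sigma; rewrite !(expect_tower hX)//; exact: nEnt.
have step6 j : {ae mu, forall sigma, E Lm (Ent (A i j `|` Q j)%fset f) sigma =
    E Lm (Ent (A i j) f) sigma + E Lm (Ent (A i j `|` Q j)%fset (avg (A i j)
      f)) sigma}.
  have PC : (A i j `<=` A i j `|` Q j)%fset := fsubsetUl _ _.
  have nP := avg_nonneg_measurable hX tau (A i j) nnf.
  have n1 := nEnt _ _ (PV j) nnf; have n2 := nEnt _ _ (CV j) nP.
  have nsm : nonneg_emeasurable (fun s => E (A i j `|` Q j)%fset (Ent (A i j)
    f) s +
      Ent (A i j `|` Q j)%fset (avg (A i j) f) s).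
    have [? ?] := nE (A i j `|` Q j)%fset _ n1; have [? ?] := n2.
    by split=> [|w]; [exact: emeasurable_funD|exact: adde_ge0].
  have := ae_eq_expect LmV (nEnt _ _ (CV j) nnf) nsm (Ent_chain_rule PC (CV j)
    nf).
  apply: filterS => sigma h; apply: (etrans h).
  by rewrite (expectD hX tau Lm sigma (nE _ _ n1) n2);
    rewrite (expect_tower hX _ _ (CLm j) LmV n1).
have step56 : {ae mu, forall sigma, forall j,
    E Lm (Ent (A i j) f) sigma + E Lm (Ent (Q j) (avg K f)) sigma <=
    E Lm (Ent (A i j `|` Q j)%fset f) sigma}.
  apply: filter_forall => j; apply: filterS2 (step5 j) (step6 j) => sigma h5 ->.
  by rewrite leeD2l.
apply: filterS3 step1 (filterI step2 step3) (filterI step4 step56) =>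
  sigma -> [h2 h3] [h4 h56].
(* The constant [s i] of the new row is enlarged to [t], so that both contributions merge into one
   sum over the columns. *)
apply: (@le_trans _ _ (t%:E * \sum_(j < m) E Lm (Ent (A i j) f) sigma +
  t%:E * \sum_(j < m) E Lm (Ent (Q j) (avg K f)) sigma)).
  apply: leeD; last exact: le_trans h3 h4.
  apply: (le_trans h2); apply: lee_wpmul2r; last by rewrite lee_fin.
  apply: sume_ge0 => j _; apply: (expect_ge0 hX) => w.
  by have [_] := nEnt _ _ (PV j) nnf.
rewrite -ge0_muleDr; last 2 first.
- apply: sume_ge0 => j _; apply: (expect_ge0 hX) => w.
  by have [_] := nEnt _ _ (PV j) nnf.
- apply: sume_ge0 => j _; apply: (expect_ge0 hX) => w.
  by have [_] := nEnt _ _ (QV j) nng.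
rewrite -big_split /=; apply: lee_wpmul2l; first by rewrite lee_fin.
by apply: lee_sum => j _.
Qed.

(** The columns are cut down to the listed rows, and these truncated columns are the Q_j of the
    induction step. The function is quantified after the list because the step uses the hypothesis
    at [avg (rows A i) f]. *)
Lemma rows_union (r : seq 'I_n) : uniq r -> (0 <= t)%R ->
  forall f : Omega -> R, nonneg_LlogL X V tau f ->
    {ae mu, forall sigma, Ent (\bigcup_(i <- r) rows A i)%fset f sigma <=
      t%:E * \sum_(j < m) E (\bigcup_(i <- r) rows A i)%fset
        (Ent (\bigcup_(i <- r) A i j)%fset f) sigma}.
Proof.
move=> + t0; elim: r => [_ f lf|i r IH /= /andP[ir ur] f lf].
  have [nnf _] := nonneg_LlogL_L1 hX lf.
  apply: aeW => sigma; rewrite !big_nil Ent0//; apply: mule_ge0;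
    first by rewrite lee_fin.
  apply: sume_ge0 => j _; rewrite big_nil expect0 Ent0//.
set Rr := (\bigcup_(k <- r) rows A k)%fset.
have RL : (Rr `<=` L)%fset by apply/bigfcupsP.
have dis : [disjoint rows A i & Rr]%fset.
  apply/fdisjointP => x xi; apply/bigfcupP => -[k /andP[kr _] xk].
  have ik : i != k by apply: contraNneq ir => ->.
  by have /fdisjointP/(_ _ xi) := disj ik; rewrite xk.
have QR j : (\bigcup_(k <- r) A k j `<=` Rr)%fset.
  apply/bigfcupsP => k kr _; apply: fsubset_trans (sub_rows k j) _.
  exact: bigfcup_sup.
apply: filterS (rows_union_step RL dis QR t0 (IH ur) lf) => sigma.
rewrite big_cons -/Rr.
by under [X in _ -> _ <= _ * X]eq_bigr do rewrite big_cons.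
Qed.

End row_induction.

Unset Implicit Arguments.
Set Strict Implicit.

Theorem lemma3p2 (d : nat) (R : realType) (disp : measure_display)
    (S : measurableType disp) (X : interaction R S) (hX : is_spin_system d X)
    (V : {fset site d}) (tau : site d -> S)
    (n m : nat) (A : 'I_n -> 'I_m -> {fset site d}) (L : {fset site d})
    (n_gt0 : (0 < n)%N) (subV : forall i j, (A i j `<=` V)%fset)
    (defL : L = (\bigcup_(i <- enum 'I_n) rows A i)%fset)
    (disj : forall i k, i != k -> [disjoint rows A i & rows A k]%fset)
    (prodL : product_along X V tau L (rows A))
    (s : 'I_n -> R) (s_gt0 : forall i, (0 < s i)%R)
    (hrow : forall (i : 'I_n) (f : config V S -> R), nonneg_LlogL X V tau f ->
      {ae gibbs X V tau, forall sigma : config V S,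
        Ent X V tau (rows A i) f sigma <=
        (s i)%:E * \sum_(j < m)
          expect X V tau (rows A i) (Ent X V tau (A i j) f) sigma}) :
  forall f : config V S -> R, nonneg_LlogL X V tau f ->
    {ae gibbs X V tau, forall sigma : config V S,
      Ent X V tau L f sigma <=
      (\big[Num.max/0%R]_(i < n) s i)%:E * \sum_(j < m)
        expect X V tau L (Ent X V tau (columns A j) f) sigma}.
Proof.
move=> f lf.
have LV : (L `<=` V)%fset.
  rewrite defL; apply/bigfcupsP => i _ _; apply/bigfcupsP => j _ _; exact: subV.
have rowsL i : (rows A i `<=` L)%fset.
  by rewrite defL; apply: bigfcup_sup; rewrite ?mem_enum.
have s_le i : (s i <= \big[Num.max/0]_(i < n) s i)%R by exact: le_bigmax.
have t0 : (0 <= \big[Num.max/0]_(i < n) s i)%R.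
  by apply: le_trans (s_le (Ordinal n_gt0)); exact: ltW.
have s_ge0 i : (0 <= s i)%R by exact: ltW.
have hrow' i g : nonneg_LlogL X V tau g ->
    {ae gibbs_prob hX V tau, forall sigma, Ent X V tau (rows A i) g sigma <=
      (s i)%:E * \sum_(j < m)
        cexpect X V tau (rows A i) (Ent X V tau (A i j) g) sigma}.
  by rewrite cexpectE; exact: hrow.
have := rows_union LV rowsL disj prodL s_le s_ge0 hrow' (enum_uniq 'I_n) t0 lf.
by rewrite -defL cexpectE.
Qed.
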